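(* Let $G$ be a finitely presented group, and let $p$ be a prime. Suppose that the derived $p$-series for $G$ has linear growth of mod $p$ homology. Then $G$ is $p$-large.
   Context: The derived $p$-series $\{D_i^{(p)}(G)\}$ of $G$ is defined recursively by $D_0^{(p)}(G)=G$ and $D_{i+1}^{(p)}(G)=[D_i^{(p)}(G),D_i^{(p)}(G)]\,(D_i^{(p)}(G))^p$; its terms are finite index subgroups of $G$. For a group $H$, $d_p(H)$ is the dimension of $H_1(H;\mathbb{F}_p)$ over the field $\mathbb{F}_p$ of order $p$. A nested sequence of finite index subgroups $\{G_i\}$ of $G$ has linear growth of mod $p$ homology if $\inf_i d_p(G_i)/[G:G_i]>0$. A group is $p$-large if it contains a normal subgroup with index a power of $p$ that admits a surjective homomorphism onto a free non-abelian group. *)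

(* Defs.v *)
From HB Require Import structures.
From mathcomp Require Import all_boot all_order all_algebra.
From mathcomp Require Import boolp classical_sets functions cardinality reals.
From mathcomp Require Import finmap freeg.

Set Implicit Arguments.
Unset Strict Implicit.
Unset Printing Implicit Defensive.

Import Order.TTheory GRing.Theory Num.Theory.

Local Open Scope classical_set_scope.
Local Open Scope group_scope.

(* A subgroup of G is an element of MathComp's groupClosed G, i.e. a predicate
   on G bundled with its closure properties. *)

Record subgroup_type (G : groupType) (S : groupClosed G) :=
  SubgroupElt { subgroup_val : G; _ : subgroup_val \in S }.

Section SubgroupType.
Variables (G : groupType) (S : groupClosed G).
Fact groupClosed_closed : group_closed [in S].
Proof. by split; [exact: gpred1 | move=> x y; exact: gpredF]. Qed.
HB.instance Definition _ := [isSub for @subgroup_val G S].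
HB.instance Definition _ := [Choice of subgroup_type S by <:].
HB.instance Definition _ :=
  SubChoice_isSubGroup.Build G [in S] (subgroup_type S) groupClosed_closed.
End SubgroupType.

Definition to_subgroup (G : groupType) (S : {pred G}) (clS : group_closed S) :
    groupClosed G :=
  HB.pack_for (groupClosed G) S (isMul1Closed.Build G S clS.1)
    (isMulClosed.Build G S (group_closedM clS))
    (isInvClosed.Build G S (group_closedV clS)).

Fact predT_closed (G : groupType) : group_closed (predT : {pred G}).
Proof. by []. Qed.

Definition whole_group (G : groupType) : groupClosed G :=
  to_subgroup (predT_closed G).

Section Generated.
Variables (G : groupType) (A : set G).

Definition generated_pred : {pred G} := fun x =>
  `[< forall S : groupClosed G, A `<=` [set` S] -> x \in S >].

Fact generated_closed : group_closed generated_pred.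
Proof.
split; first by apply/asboolP => S _; exact: gpred1.
move=> x y /asboolP xA /asboolP yA; apply/asboolP => S AS.
by apply: gpredF; [exact: xA | exact: yA].
Qed.

Definition generated_subgroup : groupClosed G := to_subgroup generated_closed.

Fact mem_generated (a : G) : A a -> a \in generated_subgroup.
Proof. by move=> Aa; apply/asboolP => S; exact. Qed.

Fact generated_sub (S : groupClosed G) :
  A `<=` [set` S] -> {subset generated_subgroup <= S}.
Proof. by move=> AS x /asboolP; exact. Qed.
End Generated.

Definition commutator_subgroup (G : groupType) (D : groupClosed G) :
    groupClosed G :=
  generated_subgroup [set [~ x, y] | x in [set` D] & y in [set` D]].

Definition power_subgroup (p : nat) (G : groupType) (D : groupClosed G) :
    groupClosed G :=
  generated_subgroup [set x ^+ p | x in [set` D]].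

Section CommPow.
Variables (p : nat) (G : groupType) (D : groupClosed G).

Definition comm_pow_pred : {pred G} := fun z =>
  `[< exists x y, [/\ x \in commutator_subgroup D,
                      y \in power_subgroup p D & z = x * y] >].

Fact commutator_subgroup_sub : {subset commutator_subgroup D <= D}.
Proof.
apply: generated_sub => _ [x /= xD [y /= yD <-]].
by rewrite commgEl gpredM ?gpredV // gpredJ.
Qed.

Fact power_subgroup_sub : {subset power_subgroup p D <= D}.
Proof. by apply: generated_sub => _ [x /= xD <-]; exact: gpredXn. Qed.

Fact commutator_subgroup_conj x y :
  x \in commutator_subgroup D -> y \in D -> x ^ y \in commutator_subgroup D.
Proof.
move=> xC yD; rewrite -[x ^ y](mulVKg x) -commgEl gpredM //.
apply: mem_generated; exists x; first exact: commutator_subgroup_sub.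
by exists y.
Qed.

Fact comm_pow_closed : group_closed comm_pow_pred.
Proof.
split; first by apply/asboolP; exists 1, 1; rewrite !gpred1 mulg1.
move=> _ _ /asboolP[x [y [xC yP ->]]] /asboolP[u [v [uC vP ->]]].
apply/asboolP; exists (x * u^-1 ^ (v / y)), (y / v); split.
- rewrite gpredM // commutator_subgroup_conj ?gpredV //.
  by apply: power_subgroup_sub; rewrite gpredF.
- by rewrite gpredF.
- by rewrite conjgE invgF invgM !mulgA mulgVK mulgK.
Qed.

(* The product set [D, D] D^p. *)
Definition comm_pow : groupClosed G := to_subgroup comm_pow_closed.
End CommPow.

Fixpoint derived_p_series (p : nat) (G : groupType) (i : nat) :
    groupClosed G :=
  if i is j.+1 then comm_pow p (derived_p_series p G j) else whole_group G.

Definition normal_subgroup (G : groupType) (N : groupClosed G) : Prop :=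
  forall x g : G, x \in N -> x ^ g \in N.

Definition left_cosets (G : groupType) (S : groupClosed G) : set (set G) :=
  range (fun g : G => [set g * h | h in [set` S]]).

(* The index of S in G; it is 0 when S has infinite index, since fset_set sends
   infinite sets to the empty one. *)
Definition subgroup_index (G : groupType) (S : groupClosed G) : nat :=
  #|` fset_set (left_cosets S)|.

(* F is free with basis the family b. *)
Definition free_on (F : groupType) (I : Type) (b : I -> F) : Prop :=
  forall (K : groupType) (f : I -> K),
  exists phi : {multiplicative F -> K},
    (forall i, phi (b i) = f i) /\
    (forall psi : {multiplicative F -> K},
       (forall i, psi (b i) = f i) -> psi =1 phi).

Definition free_group (F : groupType) : Prop :=
  exists (I : Type) (b : I -> F), free_on b.

Definition normal_closure (G : groupType) (A : set G) : groupClosed G :=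
  generated_subgroup [set r ^ g | r in A & g in [set: G]].

(* G is isomorphic to the quotient of a free group F of finite rank by the
   normal closure of a finite subset of F. *)
Definition finitely_presented (G : groupType) : Prop :=
  exists (F : groupType) (n : nat) (b : 'I_n -> F) (rels : seq F)
         (q : {multiplicative F -> G}),
    [/\ free_on b,
        (forall y : G, exists x : F, q x = y) &
        (forall x : F, q x = 1 <-> x \in normal_closure [set` rels])].

Section Homology.
Local Open Scope ring_scope.

(* n is the dimension of the quotient Z / B of subspaces B `<=` Z of V: there
   are n elements of Z whose classes modulo B form a basis of Z / B. *)
Definition is_quotient_dim (K : fieldType) (V : lmodType K) (Z B : set V)
    (n : nat) : Prop :=
  exists c : 'I_n -> V,
    [/\ (forall i, Z (c i)),
        (forall a : 'I_n -> K, B (\sum_i a i *: c i) -> forall i, a i = 0) &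
        (forall z, Z z -> exists a : 'I_n -> K, B (z - \sum_i a i *: c i))].

(* 0 when the dimension is infinite. *)
Definition quotient_dim (K : fieldType) (V : lmodType K) (Z B : set V) : nat :=
  xget 0%N [set n | is_quotient_dim Z B n].

(* The inhomogeneous bar complex of H with trivial coefficients in K, in
   degrees 0, 1 and 2, where it is K, K[H] and K[H x H]. *)
Definition bar_d1 (K : fieldType) (H : groupType) (c : {freeg H / K}) : K^o :=
  fglift (fun _ : H => 1 - 1 : K^o) c.

Definition bar_d2 (K : fieldType) (H : groupType) (c : {freeg (H * H) / K}) :
    {freeg H / K} :=
  fglift (fun gh : H * H =>
    [freeg [:: (1, gh.2)]] - [freeg [:: (1, (gh.1 * gh.2)%g)]]
      + [freeg [:: (1, gh.1)]] : {freeg H / K}) c.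

(* H_1(H; 'F_p) is ker d1 / im d2. *)
Definition d_p (p : nat) (H : groupType) : nat :=
  quotient_dim [set c | @bar_d1 'F_p H c = 0] (range (@bar_d2 'F_p H)).

(* For a nested sequence of finite index subgroups. *)
Definition linear_growth (R : realType) (p : nat) (G : groupType)
    (S : nat -> groupClosed G) : Prop :=
  0 < inf (range (fun i =>
    (d_p p (subgroup_type (S i)))%:R / (subgroup_index (S i))%:R : R)).
End Homology.

Definition p_large (p : nat) (G : groupType) : Prop :=
  exists N : groupClosed G,
    [/\ normal_subgroup N,
        (exists k : nat, subgroup_index N = (p ^ k)%N) &
        exists (F : groupType) (f : {multiplicative subgroup_type N -> F}),
          [/\ free_group F,
              ~ (forall x y : F, commute x y) &
              forall y : F, exists x, f x = y]].

(* Main.v *)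
Require Import Defs.
From HB Require Import structures.
From mathcomp Require Import all_boot all_order fingroup all_algebra ring zify.
From mathcomp Require pgroup cyclic.
From mathcomp Require Import boolp classical_sets functions cardinality reals.
From mathcomp Require Import finmap freeg.

Set Implicit Arguments.
Unset Strict Implicit.
Unset Printing Implicit Defensive.

Import Order.TTheory GRing.Theory Num.Theory.

(** Let D_i be the derived p-series, n_i its indices and d_i = d_p(D_i), so that
    n_i <= M d_i for some constant M. The group G is given by generators a_s
    and relators. A cocycle on the cover of the presentation complex with group
    D = D_i lifts to a potential on the Cayley graph of G: a function
    f : G -> F_p with f(tg) = f(t) + f(g) for t in D. Its class is the
    restriction of f to D, its value on the edge (g, s) is f(g a_s) - f(g), and
    this value depends only on the edge (Dg, s) of the finite quotient graph.
    Conversely, an edge labelling with values in any group, whose product along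
    every relator loop is trivial, has a primitive on G ([primitive_exists]).

    Sparse classes. For every eps > 0 some D_i has a nonzero class supported on
    at most eps * n_i edges ([sparse_class]). Take w independent potentials h_k
    on D_i that vanish outside an edge set S, and look for classes on D_(i+1)
    of the form sum_k F_k dh_k with F_k a potential on D_i ([descent]). The
    F_k depend on d_i * w coefficients. The integral of such a cochain around a
    relator loop depends only on the 2-cell of the cover for D_i, and is zero
    unless the cell meets S, so closedness costs at most L |S| linear
    conditions, L being the total length of the relators. As |S| = O(n_i) and
    n_i <= M d_i, a fixed large w leaves w independent solutions. They are
    nontrivial: a primitive satisfies
    H(tg) = H(t) + H(g) + sum_k F_k(t) h_k(g), and if it vanished on D_(i+1),
    which contains [D_i, D_i], the form sum_k F_k(s) h_k(t) would be symmetric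
    on D_i, which w^2 further linear conditions exclude. Over an edge of S the
    w new values are affine functions on the fibre with a common zero, so they
    all vanish on a proportion at least p^(-w) of it. The proportion of edges in
    the support is therefore multiplied by at most 1 - p^(-w) at every step, and
    tends to 0.

    Free quotients. Let h be such a sparse class with support S. Since d_i is
    then much larger than |S|, there are m independent classes phi_1..phi_m,
    m the number of generators, that vanish on every edge of every cell meeting
    S ([transverse_family]). No cell sees both h and phi, so together they
    define a morphism from D_i to the free product of Z/p and (Z/p)^m; the
    kernel of the projection of this product to Z/p x (Z/p)^m is free, and
    D_(i+1) lands in it. The map to a free group F can be written directly: put
    on every vertex g the element U(g) = u(h(g), phi(g)) of F, where u(0, e_j)
    is the basis element b_j and u is trivial elsewhere; label an edge g -> g'
    by U(g)^-1 U(g') if it lies in S and by 1 otherwise. Around a cell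
    meeting S the labels are those of the exact labelling U^-1 dU, because phi
    is constant there; the other cells carry trivial labels. The primitive Om
    restricts to a morphism D_(i+1) -> F, and it sends the commutator of alpha
    and beta to b_j when alpha in D_i only crosses h, with h(alpha) = 1, and
    beta only crosses phi, with phi(beta) = e_j ([free_quotient_of_comm_pow]).
    For F one can take the free group of the presentation of G, which is then
    forced to be nonabelian. *)

(** * Linear algebra and a growth estimate *)
Section LinearAlgebra.
Local Open Scope ring_scope.

Lemma independent_solutions (F : fieldType) (I T : finType) (A : {set T})
    (c : T -> I -> F) (k : nat) :
    (#|A| + k <= #|I|)%N ->
  exists x : 'I_k -> I -> F,
    (forall l t, t \in A -> \sum_i c t i * x l i = 0) /\
    (forall beta : 'I_k -> F,
       (forall i, \sum_l beta l * x l i = 0) -> forall l, beta l = 0).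
Proof.
move=> ck.
pose C : 'M[F]_(#|I|, #|A|) := \matrix_(i, t) c (enum_val t) (enum_val i).
pose B := row_base (kermx C).
have kB : (k <= \rank (kermx C))%N.
  rewrite mxrank_ker leq_subRL.
    by rewrite (leq_trans _ ck) // leq_add2r rank_leq_col.
  by rewrite rank_leq_row.
exists (fun l i => B (widen_ord kB l) (enum_rank i)); split.
  move=> l t tA.
  have BC : B *m C = 0 by apply/sub_kermxP; rewrite eq_row_base.
  have /matrixP/(_ (widen_ord kB l) (enum_rank_in tA t)) := BC.
  rewrite !mxE (reindex enum_rank) /=; last exact/onW_bij/enum_rank_bij.
  move=> E; rewrite -[RHS]E; apply: eq_bigr => i _.
  by rewrite [C _ _]mxE enum_rankK enum_rankK_in // mulrC.
move=> beta b0 l.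
have fB : row_free B by exact: row_base_free.
pose u : 'rV[F]_(\rank (kermx C)) :=
  \row_j (if insub (j : nat) is Some i then beta i else 0).
have uB : u *m B = 0.
  apply/rowP => j; rewrite !mxE -[RHS](b0 (enum_val j)).
  rewrite (bigID (fun i : 'I_(\rank (kermx C)) => (i < k)%N)) /=.
  rewrite addrC big1 ?add0r.
    rewrite (big_ord_narrow kB); apply: eq_bigr => i _.
    rewrite enum_valK !mxE insubT //= => ik.
    by congr (beta _ * _); apply: val_inj.
  by move=> i ik; rewrite !mxE insubF ?mul0r //; exact: negbTE.
have /rowP/(_ (widen_ord kB l)) : u = 0.
  by apply: (row_free_inj fB); rewrite uB mul0mx.
by rewrite !mxE insubT //= => lk; rewrite (_ : Sub _ _ = l) //; apply: val_inj.
Qed.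

Variable p : nat.

(** A subgroup of F_p^w is a subspace, so it is everything as soon as no nonzero
    linear form vanishes on it. *)
Lemma Fp_closed_full (w : nat) (P : ('I_w -> 'F_p) -> Prop) :
    P (fun=> 0) -> (forall u v, P u -> P v -> P (fun l => u l + v l)) ->
    (forall beta, (forall v, P v -> \sum_l beta l * v l = 0) ->
       forall l, beta l = 0) ->
  forall v, P v.
Proof.
move=> P0 PD Pindep v.
pose A := [set x : 'rV['F_p]_w | `[< P (fun l => x 0 l) >]].
have PM (n : nat) (c : 'F_p) u : P u -> P (fun l => c * u l).
  move=> Pu; rewrite -[c]natr_Zp.
  elim: (nat_of_ord c) => [|q IH].
    rewrite (_ : (fun _ => _) = (fun=> 0)) //.
    by apply/funext => l; rewrite mul0r.
  rewrite (_ : (fun _ => _) = (fun l => q%:R * u l + u l)); first exact: PD.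
  by apply/funext => l; rewrite mulrSr mulrDl mul1r.
have Psum (I : Type) (r : seq I) (f : I -> 'I_w -> 'F_p) :
    (forall i, P (f i)) -> P (fun l => \sum_(i <- r) f i l).
  move=> Pf; elim: r => [|i r IH].
    rewrite (_ : (fun _ => _) = (fun=> 0)) //.
    by apply/funext => l; rewrite big_nil.
  rewrite (_ : (fun _ => _) = (fun l => f i l + \sum_(j <- r) f j l)).
    exact: PD.
  by apply/funext => l; rewrite big_cons.
pose M : 'M['F_p]_(#|A|, w) := \matrix_(i < #|A|) enum_val i.
have PMrow (i : 'I_#|A|) : P (fun l => M i l).
  have := enum_valP i; rewrite inE => /asboolP.
  by congr P; apply/funext => l; rewrite !mxE.
have full : row_full M.
  rewrite -cokermx_eq0; apply/eqP/matrixP => l j; rewrite [RHS]mxE.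
  apply: (Pindep (fun l => cokermx M l j)) => u Pu.
  have uA : \row_l u l \in A.
    rewrite inE; apply/asboolP; move: Pu; congr P.
    by apply/funext => i; rewrite mxE.
  have /matrixP/(_ (enum_rank_in uA (\row_l u l)) j) := mulmx_coker M.
  rewrite !mxE => E; rewrite -[RHS]E; apply: eq_bigr => i _.
  by rewrite mulrC !mxE enum_rankK_in // mxE.
have [u uE] := submxP (submx_full (\row_l v l) full).
rewrite (_ : v = fun l => \sum_i u 0 i * M i l).
  by apply: Psum => i; apply: PM.
by apply/funext => l; have /rowP/(_ l) := uE; rewrite !mxE => ->.
Qed.

End LinearAlgebra.

(** Bernoulli's inequality (1 + 1/a)^k >= 1 + k/a without denominators. *)
Lemma bernoulli_nat a k : (a + k) * a ^ k <= a * a.+1 ^ k.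
Proof.
elim: k => [|k IH]; first by rewrite addn0 leqnn.
rewrite (expnS a.+1) mulnCA.
apply: leq_trans (leq_mul (leqnn a.+1) IH).
rewrite expnS !mulnA leq_mul2r; apply/orP; right.
rewrite mulSn mulnDr mulnDl mulSn (mulnC k a) addnCA.
by rewrite leq_add2r leq_addr.
Qed.

(** The geometric decay of the supports at ratio (q - 1)/q. *)
Lemma expn_ratio_unbounded q K : 1 < q -> exists k, K * q.-1 ^ k <= q ^ k.
Proof.
case: q => [|[|q]] // _; exists (q.+1 * K) => /=.
rewrite -(leq_pmul2l (ltn0Sn q)); apply: leq_trans (bernoulli_nat _ _).
by rewrite mulnA leq_mul2r leq_addl orbT.
Qed.

Local Open Scope group_scope.

(** * Presentations and integration on the Cayley graph *)
Section GroupMorphisms.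
Variables (G H : groupType) (f : {multiplicative G -> H}).

Lemma morph1 : f 1 = 1.
Proof. by apply: (@mulgI _ (f 1)); rewrite -gmulfM !mulg1. Qed.

(** Between groups a multiplicative map is automatically unital; this packs that
    fact so that the theory of unital morphisms applies. *)
Definition group_morphism : UMagmaMorphism.type G H :=
  HB.pack_for (UMagmaMorphism.type G H) (Multiplicative.sort f)
    (Multiplicative_isUMagmaMorphism.Build G H f morph1).

Lemma morphV : {morph f : x / x^-1}.
Proof. exact: (gmulfV group_morphism). Qed.

Lemma morphF : {morph f : x y / x / y}.
Proof. exact: (gmulfF group_morphism). Qed.

Lemma morphJ : {morph f : x y / x ^ y}.
Proof. exact: (gmulfJ group_morphism). Qed.

Lemma morphX n : {morph f : x / x ^+ n}.
Proof. exact: (gmulfXn group_morphism). Qed.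
End GroupMorphisms.

Definition letter_val (T : groupType) (I : Type) (t : I -> T)
    (l : I * bool) : T :=
  if l.2 then t l.1 else (t l.1)^-1.

Definition word_val (T : groupType) (I : Type) (t : I -> T)
    (w : seq (I * bool)) : T :=
  \prod_(l <- w) letter_val t l.

Lemma word_val_morph (T T' : groupType) (I : Type) (t : I -> T)
    (f : {multiplicative T -> T'}) w :
  f (word_val t w) = word_val (f \o t) w.
Proof.
rewrite /word_val (big_morph f (@gmulfM _ _ f) (@morph1 _ _ f)).
apply: eq_bigr => -[i []] _ //=.
exact: morphV.
Qed.

Fact word_vals_closed (T : groupType) (I : Type) (t : I -> T) :
  group_closed ((fun x => `[< exists w, x = word_val t w >]) : {pred T}).
Proof.
split; first by apply/asboolP; exists [::]; rewrite /word_val big_nil.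
move=> _ _ /asboolP[v ->] /asboolP[w ->]; apply/asboolP.
exists (v ++ [seq (l.1, ~~ l.2) | l <- rev w]).
rewrite /word_val big_cat /= big_map; congr (_ * _).
rewrite -[in LHS](revK w) -prodgV; apply: eq_bigr => -[i []] _ //=.
by rewrite /letter_val /= invgK.
Qed.

(** The elements spelled by words form a subgroup S. The universal property maps
    F to S, and its uniqueness part forces the composite F -> S -> F to be the
    identity. *)
Lemma free_on_generated (F : groupType) (I : Type) (b : I -> F) :
  free_on b -> forall x, exists w, x = word_val b w.
Proof.
move=> freeF x.
pose S := to_subgroup (word_vals_closed b).
have bS i : b i \in S.
  by apply/asboolP; exists [:: (i, true)]; rewrite /word_val big_seq1.
have [f [fb _]] := freeF (subgroup_type S) (fun i => SubgroupElt (bS i)).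
have [g [_ gU]] := freeF F b.
have /asboolP[w xw] : val (f x) \in S by exact: valP.
exists w; rewrite -xw.
transitivity (g x); first exact: (gU idfun).
symmetry; apply: (gU [the {multiplicative F -> F} of val \o f]) => i /=.
by rewrite fb.
Qed.

(** A presentation through its universal property, so that no normal closure
    appears later. *)
Record presents (G : groupType) (m : nat) (a : 'I_m -> G)
    (ws : seq (seq ('I_m * bool))) : Prop := Presents {
  pres_gen : forall g, exists w, g = word_val a w;
  pres_rel : forall w, w \in ws -> word_val a w = 1;
  pres_univ : forall (T : groupType) (t : 'I_m -> T),
    (forall w, w \in ws -> word_val t w = 1) ->
    exists f : {multiplicative G -> T}, forall s, f (a s) = t s }.

Lemma factor_through_surjection (F G T : groupType) (q : {multiplicative F -> G})
    (f : {multiplicative F -> T}) :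
    (forall y, exists x, q x = y) -> (forall x, q x = 1 -> f x = 1) ->
  exists h : {multiplicative G -> T}, forall x, h (q x) = f x.
Proof.
move=> /choice[s sK] kq.
have fE x : f (s (q x)) = f x.
  apply: divg1_eq; rewrite -morphF; apply: kq.
  by rewrite morphF sK mulgV.
have hM : {morph f \o s : x y / x / y}.
  by move=> x y /=; rewrite -morphF -[RHS]fE morphF !sK.
pose h := HB.pack_for {multiplicative G -> T} (f \o s)
  (isGroupMorphism.Build G T (f \o s) hM).
by exists h => x /=; exact: fE.
Qed.

Lemma finitely_presented_presentation (G : groupType) :
  finitely_presented G ->
  exists (m : nat) (F : groupType) (b : 'I_m -> F)
      (q : {multiplicative F -> G}) ws,
    [/\ free_on b, forall x, exists w, x = word_val b w & presents (q \o b) ws].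
Proof.
move=> [F [n [b [rels [q [freeF qsurj qker]]]]]].
have gen := free_on_generated freeF.
have [wd wdE] := choice gen.
exists n, F, b, q, (map wd rels); split=> //; split.
- move=> g; have [x <-] := qsurj g; have [w ->] := gen x.
  by exists w; rewrite word_val_morph.
- move=> _ /mapP[r rR ->]; rewrite -word_val_morph -wdE; apply/qker.
  apply: mem_generated; exists r => //; exists 1 => //.
  exact: conjg1.
- move=> T t tR; have [f [fb _]] := freeF T t.
  have fw w : f (word_val b w) = word_val t w.
    rewrite word_val_morph; apply: eq_bigr => l _.
    by rewrite /letter_val /= fb.
  have fker x : q x = 1 -> f x = 1.
    move/qker => xN.
    have kc : group_closed ((fun x => `[< f x = 1 >]) : {pred F}).
      split; first by apply/asboolP; exact: morph1.
      move=> y z /asboolP fy /asboolP fz; apply/asboolP.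
      by rewrite morphF fy fz mulgV.
    suff : x \in to_subgroup kc by move/asboolP.
    apply: generated_sub xN => _ [r /= rR [g _ <-]].
    apply/asboolP; rewrite morphJ [r]wdE fw tR ?conj1g //.
    exact: map_f.
  have [h hq] := factor_through_surjection qsurj fker.
  by exists h => s /=; rewrite hq.
Qed.

(** The unrestricted wreath product T wr G: the base group of functions G -> T is
    twisted by right translations. A morphism from G to it that lifts the
    identity of G is the same thing as a T-valued 1-cocycle of the Cayley complex,
    which turns the universal property of a presentation into an integration
    theorem. *)
Record wreath (T G : groupType) := Wreath { wfun : G -> T; wbase : G }.

Section Wreath.
Variables T G : groupType.
HB.instance Definition _ := gen_eqMixin (wreath T G).
HB.instance Definition _ := gen_choiceMixin (wreath T G).
Implicit Types x y : wreath T G.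
Definition wreath_mul x y :=
  Wreath (fun g => wfun x g * wfun y (g * wbase x)) (wbase x * wbase y).
Definition wreath_one : wreath T G := Wreath (fun=> 1) 1.
Definition wreath_inv x :=
  Wreath (fun g => (wfun x (g / wbase x))^-1) (wbase x)^-1.
Fact wreath_mulA : associative wreath_mul.
Proof.
move=> [f x] [g y] [h z]; rewrite /wreath_mul /= mulgA; congr Wreath.
by apply/funext => u; rewrite !mulgA.
Qed.
Fact wreath_mul1 : left_id wreath_one wreath_mul.
Proof.
move=> [f x]; rewrite /wreath_mul /= mul1g; congr Wreath.
by apply/funext => u; rewrite mul1g mulg1.
Qed.
Fact wreath_1mul : right_id wreath_one wreath_mul.
Proof.
move=> [f x]; rewrite /wreath_mul /= mulg1; congr Wreath.
by apply/funext => u; rewrite mulg1.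
Qed.
Fact wreath_mulV : left_inverse wreath_one wreath_inv wreath_mul.
Proof.
move=> [f x]; rewrite /wreath_mul /= mulVg; congr Wreath.
by apply/funext => u; rewrite mulVg.
Qed.
Fact wreath_Vmul : right_inverse wreath_one wreath_inv wreath_mul.
Proof.
move=> [f x]; rewrite /wreath_mul /= mulgV; congr Wreath.
by apply/funext => u; rewrite mulgK mulgV.
Qed.
HB.instance Definition _ := isGroup.Build (wreath T G)
  wreath_mulA wreath_mul1 wreath_1mul wreath_mulV wreath_Vmul.
End Wreath.

(** An inverse letter runs backwards through the edge from [g / a s] to [g], so it
    contributes the inverse of the label at [g / a s]. *)
Fixpoint line_integral (G T : groupType) (I : Type) (a : I -> G)
    (l : G -> I -> T) (g : G) (w : seq (I * bool)) : T :=
  match w with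
  | [::] => 1
  | (s, true) :: w' => l g s * line_integral a l (g * a s) w'
  | (s, false) :: w' =>
      (l (g / a s) s)^-1 * line_integral a l (g / a s) w'
  end.

Section Integration.
Variables (G : groupType) (m : nat) (a : 'I_m -> G).
Variable ws : seq (seq ('I_m * bool)).
Hypothesis presG : presents a ws.

(** Connectedness of the Cayley graph. *)
Lemma pres_ind (P : G -> Prop) :
  P 1 -> (forall g s, P g <-> P (g * a s)) -> forall g, P g.
Proof.
move=> P1 PS g; have [w ->] := pres_gen presG g.
elim/last_ind: w => [|w [s e] IH]; first by rewrite /word_val big_nil.
rewrite /word_val big_rcons -/(word_val a w) /=; case: e; rewrite /letter_val.
  exact/(PS (word_val a w) s).
by apply/(PS (word_val a w / a s) s); rewrite mulgVK.
Qed.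

Lemma word_val_wreath (T : groupType) (l : G -> 'I_m -> T) w :
  word_val (fun s => Wreath (l^~ s) (a s)) w
  = Wreath (fun g => line_integral a l g w) (word_val a w).
Proof.
rewrite /word_val; elim: w => [|[s e] w IH]; first by rewrite !big_nil.
by rewrite !big_cons IH; case: e.
Qed.

(** The Poincare lemma for the Cayley complex: the labels define a morphism from
    G to the wreath product, and its function part evaluated at 1 is the
    primitive. *)
Lemma primitive_exists (T : groupType) (l : G -> 'I_m -> T) :
    (forall w, w \in ws -> forall g, line_integral a l g w = 1) ->
  exists2 H : G -> T, H 1 = 1 & forall g s, H (g * a s) = H g * l g s.
Proof.
move=> lrel; have [|f fa] := pres_univ presG (t := fun s => Wreath (l^~ s) (a s)).
  move=> w wR; rewrite word_val_wreath (pres_rel presG) //.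
  by congr Wreath; apply/funext => g; rewrite lrel.
have fb g : wbase (f g) = g.
  move: g; apply: pres_ind => [|g s]; first by rewrite morph1.
  rewrite gmulfM fa /=; split=> [->//|]; exact: mulIg.
exists (fun g => wfun (f g) 1); first by rewrite morph1.
by move=> g s; rewrite gmulfM fa /= fb mul1g.
Qed.

End Integration.

(** Edges are recorded by their positive orientation: the pair (x, s) is the edge
    from [x] to [x * a s], whichever way the path runs through it. *)
Fixpoint word_edges (G : groupType) (I : Type) (a : I -> G) (g : G)
    (w : seq (I * bool)) : seq (G * I) :=
  match w with
  | [::] => [::]
  | (s, true) :: w' => (g, s) :: word_edges a (g * a s) w'
  | (s, false) :: w' => (g / a s, s) :: word_edges a (g / a s) w'
  end.

Lemma size_word_edges (G : groupType) (I : Type) (a : I -> G) g w :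
  size (word_edges a g w) = size w.
Proof. by elim: w g => [|[s []] w IH] g //=; rewrite IH. Qed.

Lemma word_edges_translate (G : groupType) (I : Type) (a : I -> G) d g w :
  word_edges a (d * g) w = [seq (d * e.1, e.2) | e <- word_edges a g w].
Proof. by elim: w g => [|[s []] w IH] g //=; rewrite -mulgA IH. Qed.

Lemma line_integral_translate (G T : groupType) (I : Type) (a : I -> G)
    (l : G -> I -> T) d g w :
  line_integral a (fun x s => l (d * x) s) g w = line_integral a l (d * g) w.
Proof. by elim: w g => [|[s []] w IH] g //=; rewrite IH !mulgA. Qed.

(** The label only has to be a coboundary on the edges of the path itself. *)
Lemma line_integral_exact (G T : groupType) (I : eqType) (a : I -> G)
    (l : G -> I -> T) (H : G -> T) g w :
    (forall x s, (x, s) \in word_edges a g w -> l x s = (H x)^-1 * H (x * a s)) ->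
  line_integral a l g w = (H g)^-1 * H (g * word_val a w).
Proof.
rewrite /word_val; elim: w g => [|[s e] w IH] g lH.
  by rewrite big_nil mulg1 mulVg.
rewrite big_cons mulgA /=; case: e lH => lH /=.
  rewrite IH => [|x t xt]; last by rewrite lH // inE xt orbT.
  by rewrite lH ?mem_head // mulgA mulgK.
rewrite IH => [|x t xt]; last by rewrite lH // inE xt orbT.
by rewrite lH ?mem_head // mulgVK invgM invgK mulgA mulgK.
Qed.

Lemma line_integral_triv (G T : groupType) (I : eqType) (a : I -> G)
    (l : G -> I -> T) g w :
    (forall x s, (x, s) \in word_edges a g w -> l x s = 1) ->
  line_integral a l g w = 1.
Proof.
by move=> l1; rewrite (line_integral_exact (H := fun=> 1)) ?mulVg.
Qed.

Section AdditiveIntegrals.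
Variables (p : nat) (G : groupType) (I : Type) (a : I -> G).
Local Open Scope ring_scope.
Implicit Types l : G -> I -> 'F_p.

Lemma line_integral_sum (K : Type) (r : seq K) (c : K -> 'F_p)
    (l : K -> G -> I -> 'F_p) g w :
  line_integral a (fun x s => \sum_(k <- r) c k * l k x s : 'F_p) g w
  = \sum_(k <- r) c k * line_integral a (l k) g w.
Proof.
elim: w g => [|[s e] w IH] g /=.
  by rewrite big1 // => k _; rewrite [(1%g : 'F_p)]/(0 : 'F_p) mulr0.
case: e => /=; rewrite IH.
  rewrite -[LHS]/(_ + _ : 'F_p) -big_split /=; apply: eq_bigr => k _.
  by rewrite -mulrDr.
rewrite -[LHS]/(- _ + _ : 'F_p) -sumrN -big_split /=; apply: eq_bigr => k _.
by rewrite -mulrN -mulrDr.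
Qed.

Lemma line_integralD l l' g w :
  line_integral a (fun x s => l x s + l' x s : 'F_p) g w
  = line_integral a l g w + line_integral a l' g w.
Proof.
elim: w g => [|[s e] w IH] g /=; first by rewrite -[RHS]/(0 + 0 : 'F_p) addr0.
case: e => /=; rewrite IH; first exact: addrACA.
rewrite -[LHS]/(- (_ + _) + _ : 'F_p) -[RHS]/(- _ + _ + (- _ + _) : 'F_p).
by rewrite opprD addrACA.
Qed.

End AdditiveIntegrals.

(** * Potentials *)

(** A potential is a lift to the Cayley graph of an F_p-valued 1-cocycle on its
    quotient by D; its cohomology class is its restriction to D. *)
Definition potential (p : nat) (G : groupType) (D : groupClosed G)
    (f : G -> 'F_p) : Prop :=
  forall d g, d \in D -> f (d * g) = (f d + f g)%R.

Lemma comm_pow_sub (p : nat) (G : groupType) (D : groupClosed G) :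
  {subset comm_pow p D <= D}.
Proof.
move=> _ /asboolP[x [y [xC yP ->]]].
by rewrite gpredM ?(commutator_subgroup_sub xC) ?(power_subgroup_sub yP).
Qed.

Lemma commg_comm_pow (p : nat) (G : groupType) (D : groupClosed G) x y :
  x \in D -> y \in D -> [~ x, y] \in comm_pow p D.
Proof.
move=> xD yD; apply/asboolP; exists [~ x, y], 1.
rewrite mulg1 gpred1; split=> //.
by apply: mem_generated; exists x => //; exists y.
Qed.

Section Potentials.
Variables (p : nat) (G : groupType) (D : groupClosed G).
Local Open Scope ring_scope.
Implicit Types f : G -> 'F_p.

Lemma potential1 f : potential D f -> f 1%g = 0.
Proof.
move=> Df; apply: (@addrI _ (f 1%g)).
by rewrite -Df ?gpred1 // mulg1 addr0.
Qed.

Lemma potentialV f d : potential D f -> d \in D -> f d^-1%g = - f d.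
Proof.
move=> Df dD; apply: (@addrI _ (f d)).
by rewrite -Df // mulgV potential1 // subrr.
Qed.

Lemma potentialX f d n : potential D f -> d \in D -> f (d ^+ n)%g = n%:R * f d.
Proof.
move=> Df dD; elim: n => [|n IH]; first by rewrite expg0 potential1 // mul0r.
by rewrite expgS Df // IH mulrS mulrDl mul1r.
Qed.

Lemma potential_lin (K : Type) (r : seq K) (c : K -> 'F_p) (f : K -> G -> 'F_p) :
  (forall k, potential D (f k)) ->
  potential D (fun g => \sum_(k <- r) c k * f k g).
Proof.
move=> Df d g dD; rewrite -big_split /=; apply: eq_bigr => k _.
by rewrite Df // mulrDr.
Qed.

(** On D a potential is a homomorphism to F_p, so it kills commutators and p-th
    powers. *)
Lemma potential_comm_pow f d : prime p -> potential D f ->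
  d \in comm_pow p D -> f d = 0.
Proof.
move=> pp Df dD'.
have fcl : group_closed ((fun x => (x \in D) && (f x == 0)) : {pred G}).
  split; first by apply/andP; rewrite gpred1 potential1.
  move=> x y /andP[xD /eqP fx] /andP[yD /eqP fy]; apply/andP; split.
    exact: gpredF.
  by rewrite Df // potentialV // fx fy subrr.
have commD : {subset commutator_subgroup D <= to_subgroup fcl}.
  apply: generated_sub => _ [x /= xD [y /= yD <-]].
  rewrite commgEl conjgE; apply/andP; split.
    by rewrite !gpredM ?gpredV.
  rewrite !Df ?gpredV //; apply/eqP; rewrite !(potentialV Df) //; ring.
have powD : {subset power_subgroup p D <= to_subgroup fcl}.
  apply: generated_sub => _ [x /= xD <-].
  apply/andP; split; first exact: gpredXn.
  by rewrite potentialX // pchar_Fp_0 // mul0r.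
have /asboolP[x [y [/commD xK /powD yK ->]]] := dD'.
have : (x * y \in to_subgroup fcl)%g by rewrite gpredM.
by case/andP => _ /eqP.
Qed.

End Potentials.

(** Here [H] is a primitive of the cochain sum_k F_k dh_k, the product of two
    families of classes on D. *)
Section TwistedPotential.
Variables (p : nat) (G : groupType) (m : nat) (a : 'I_m -> G).
Variable ws : seq (seq ('I_m * bool)).
Hypotheses (pp : prime p) (presG : presents a ws).
Variables (D : groupClosed G) (w : nat) (h F : 'I_w -> G -> 'F_p).
Hypotheses (hD : forall k, potential D (h k)) (FD : forall k, potential D (F k)).
Variable H : G -> 'F_p.
Local Open Scope ring_scope.
Hypothesis H1 : H 1%g = 0.
Hypothesis dH : forall g s,
  H (g * a s)%g = H g + \sum_k F k g * (h k (g * a s)%g - h k g).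

(** Translating by [d] changes the cochain sum_k F_k dh_k by the exact cochain
    sum_k F_k(d) dh_k, and primitives are unique up to a constant. *)
Lemma twisted_translate d g : d \in D ->
  H (d * g)%g = H d + H g + \sum_k F k d * h k g.
Proof.
move=> dD.
pose E x := H (d * x)%g - (H d + H x + \sum_k F k d * h k x).
suff E0 x : E x = 0 by apply/eqP; rewrite -subr_eq0; apply/eqP; exact: E0.
move: x; apply: (pres_ind presG) => [|x s].
  rewrite /E mulg1 H1 big1 ?addr0 ?subrr // => k _.
  by rewrite (potential1 (hD k)) mulr0.
suff -> : E (x * a s)%g = E x by [].
rewrite /E mulgA !dH.
have -> : \sum_k F k (d * x)%g * (h k (d * x * a s)%g - h k (d * x)%g) =
    \sum_k F k d * (h k (x * a s)%g - h k x)
    + \sum_k F k x * (h k (x * a s)%g - h k x).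
  rewrite -big_split; apply: eq_bigr => k _ /=.
  rewrite -mulgA !(hD k _ dD) (FD k _ dD); ring.
have -> : \sum_k F k d * (h k (x * a s)%g - h k x) =
   \sum_k F k d * h k (x * a s)%g - \sum_k F k d * h k x.
  by rewrite -sumrB; apply: eq_bigr => k _; rewrite mulrBr.
ring.
Qed.

Lemma twisted_potential : potential (comm_pow p D) H.
Proof.
move=> d g dD'.
have dD := comm_pow_sub dD'.
rewrite twisted_translate // big1 ?addr0 // => k _.
by rewrite (potential_comm_pow pp (FD k)) // mul0r.
Qed.

(** If [H] kills D' = [D, D] D^p then H(st) = H(ts), and the difference of the
    two expansions of [twisted_translate] is the antisymmetrization of the
    form. This is what detects nontrivial classes. *)
Lemma twisted_symmetric :
    (forall d, d \in comm_pow p D -> H d = 0) ->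
  forall s t, s \in D -> t \in D -> \sum_k F k s * h k t = \sum_k F k t * h k s.
Proof.
move=> HD' s t sD tD.
have : H (s * t)%g = H (t * s)%g.
  rewrite commgC (_ : t * s * [~ s, t] = [~ s, t] ^ (t * s)^-1 * (t * s))%g.
    have cD' : ([~ s, t] ^ (t * s)^-1 \in comm_pow p D)%g.
      rewrite conjRg; apply: commg_comm_pow; apply: gpredJ => //.
        by rewrite gpredV gpredM.
      by rewrite gpredV gpredM.
    by rewrite (twisted_potential _ cD') (HD' _ cD') add0r.
  by rewrite conjgE invgK -(mulgA (t * s)%g) mulgVK.
rewrite !twisted_translate // [H s + _]addrC; exact: addrI.
Qed.
End TwistedPotential.

(** * Finite quotients and the size of supports *)

(** The quotient is kept as an abstract finite group: its elements are the
    vertices of the quotient graph, and pairs (y, s) are its edges. *)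
Record finite_quotient (G : groupType) (D : groupClosed G) (Q : finGroupType)
    (rho : {multiplicative G -> Q}) : Prop := FiniteQuotient {
  quot_surj : forall y, exists g, rho g = y;
  quot_ker : forall g, rho g = 1 <-> g \in D }.

Lemma quot_eq (G : groupType) (D : groupClosed G) (Q : finGroupType)
    (rho : {multiplicative G -> Q}) g g' :
  finite_quotient D rho -> (rho g = rho g') <-> (g / g' \in D).
Proof.
move=> qD; rewrite -(quot_ker qD) morphF; split=> [->|]; first exact: mulgV.
exact: divg1_eq.
Qed.

Section Counting.
Variables (G : groupType) (D D' : groupClosed G) (Q Q' : finGroupType).
Variables (rho : {multiplicative G -> Q}) (rho' : {multiplicative G -> Q'}).
Hypotheses (qD : finite_quotient D rho) (qD' : finite_quotient D' rho').
Hypothesis D'D : {subset D' <= D}.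

(** All fibres of G/D' -> G/D are translates of the kernel. *)
Lemma quot_refine : exists pi : Q' -> Q,
  (forall g, pi (rho' g) = rho g) /\
  (forall y, (#|[set x | pi x == y]| * #|Q| = #|Q'|)%N).
Proof.
have [sec secK] := choice (quot_surj qD').
pose pi y := rho (sec y).
have piE g : pi (rho' g) = rho g.
  by apply/(quot_eq _ _ qD)/D'D/(quot_eq _ _ qD'); rewrite secK.
have piM : {morph pi : x y / x * y}.
  by move=> x y; rewrite -[x]secK -[y]secK -gmulfM !piE gmulfM.
exists pi; split=> // y.
have [g gy] := quot_surj qD y.
have fib z : #|[set x | pi x == z]| = #|[set x | pi x == 1]|.
  have [k kz] := quot_surj qD z.
  have kz' : pi (rho' k) = z by rewrite piE.
  have -> : [set x | pi x == z] = [set rho' k * x | x in [set x | pi x == 1]].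
    apply/setP => x; rewrite inE; apply/eqP/imsetP => [xz|[u]].
      exists ((rho' k)^-1 * x); last by rewrite mulVKg.
      rewrite inE; apply/eqP; rewrite -morphV piM xz piE morphV kz mulVg //.
    by rewrite inE => /eqP u1 ->; rewrite piM u1 kz' mulg1.
  by rewrite card_imset //; exact: mulgI.
rewrite (fib y) mulnC -sum_nat_const -[RHS]sum1_card (partition_big pi predT) //=.
apply: eq_bigr => z _; rewrite -(fib z) -sum1_card; apply: eq_bigl => x.
by rewrite !inE.
Qed.

(** A translation by D moves any nonempty level set of [v] on a fibre into any
    other one, so these sets have the same size. The zero level is nonempty, so
    it takes up at least a fraction #|F|^(-w) of the fibre. *)
Lemma support_count (F : finZmodType) (I : finType) (w : nat)
    (v : 'I_w -> G -> I -> F) (S : {set Q * I}) :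
    (forall l d g s, d \in D' -> v l (d * g) s = v l g s) ->
    (forall l u g g' s, u \in D -> rho g = rho g' ->
      v l (u * g)%g s - v l g s = v l (u * g')%g s - v l g' s)%R ->
    (forall y s, exists2 g, rho g = y & forall l, v l g s = 0%R) ->
    (forall l g s, v l g s <> 0%R -> (rho g, s) \in S) ->
  exists2 S' : {set Q' * I},
    forall l g s, v l g s <> 0%R -> (rho' g, s) \in S' &
    (#|F| ^ w * #|S'| * #|Q| <= (#|F| ^ w).-1 * #|S| * #|Q'|)%N.
Proof.
move=> vD' vD vZ vS.
have [pi [piE piC]] := quot_refine.
have [sec secK] := choice (quot_surj qD').
pose V x s : {ffun 'I_w -> F} := [ffun l => v l (sec x) s].
have VE g s : V (rho' g) s = [ffun l => v l g s].
  apply/ffunP => l; rewrite !ffunE.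
  have gD' : sec (rho' g) / g \in D' by apply/(quot_eq _ _ qD'); rewrite secK.
  by rewrite -[in LHS](mulgVK g (sec _)) vD'.
pose S' := [set e : Q' * I | V e.1 e.2 != 0%R].
exists S'.
  move=> l g s vn0; rewrite inE /= VE; apply/eqP => /ffunP/(_ l).
  by rewrite !ffunE.
pose q := (#|F| ^ w)%N.
pose X y := [set x | pi x == y].
have S'X y s : (q * #|[set x in X y | (x, s) \in S']| <= q.-1 * #|X y|)%N.
  pose fib t := [set x in X y | V x s == t].
  have fib0 t : (#|fib t| <= #|fib 0%R|)%N.
    have [->|[x1 x1t]] := set_0Vmem (fib t); first by rewrite cards0.
    have [g1 g1x] := quot_surj qD' x1.
    have [g0 g0y v0] := vZ y s.
    move: x1t; rewrite -g1x !inE piE => /andP[/eqP g1y /eqP V1].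
    have uD : g0 / g1 \in D by apply/(quot_eq _ _ qD); rewrite g0y.
    rewrite -(card_imset _ (@mulgI _ (rho' (g0 / g1)))).
    apply/subset_leq_card/fintype.subsetP => _ /imsetP[x + ->].
    have [g <-] := quot_surj qD' x.
    rewrite -gmulfM !inE !piE => /andP[/eqP gy /eqP Vt].
    apply/andP; split.
      by rewrite gmulfM morphF g0y g1y gy mulgV mul1g.
    apply/eqP/ffunP => l; rewrite VE !ffunE.
    have := vD l _ g g1 s uD; rewrite gy g1y => /(_ erefl).
    rewrite mulgVK v0.
    have -> : v l g1 s = v l g s.
      by move: V1 Vt; rewrite !VE => <- /ffunP/(_ l); rewrite !ffunE.
    by rewrite sub0r => /(congr1 (fun z => z + v l g s)%R); rewrite subrK addNr.
  have cX : (#|X y| <= q * #|fib 0%R|)%N.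
    rewrite -sum1_card (partition_big (V^~ s) predT) //=.
    have -> : q = #|{ffun 'I_w -> F}| by rewrite card_ffun card_ord.
    rewrite -sum_nat_const; apply: leq_sum => t _.
    apply: leq_trans (fib0 t); rewrite -sum1_card.
    by apply: eq_leq; apply: eq_bigl => x; rewrite !inE.
  have cS' : (#|[set x in X y | (x, s) \in S']| + #|fib 0%R| = #|X y|)%N.
    rewrite -(cardsID [set x | (x, s) \in S'] (X y)); congr (_ + _)%N.
      by apply: eq_card => x; rewrite !inE.
    by apply: eq_card => x; rewrite !inE negbK andbC.
  rewrite -cS' in cX *.
  move: cX; move: (#|_|) => A; move: (#|_|) => B.
  have : (0 < q)%N.
    by rewrite expn_gt0; apply/orP; left; apply/card_gt0P; exists 0%R.
  case: q => // r _ /=; nia.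
have cS' : #|S'| = (\sum_(e in S) #|[set x in X e.1 | (x, e.2) \in S']|)%N.
  rewrite -sum1_card (partition_big (fun e => (pi e.1, e.2)) (mem S)) /=.
    apply: eq_bigr => -[y s] _ /=; rewrite -sum1_card.
    rewrite (reindex_onto (fun x => (x, s)) fst) /=.
      apply: eq_bigl => x; rewrite !inE /= eqxx andbT.
      by rewrite xpair_eqE eqxx andbT andbC.
    by move=> [x t] /= /andP[_]; rewrite xpair_eqE /= => /andP[_ /eqP ->].
  move=> [x s]; have [g <-] := quot_surj qD' x; rewrite inE /= VE piE => Vn0.
  have [l vl] : exists l, v l g s <> 0%R.
    apply/existsNP => v0; case/eqP: Vn0; apply/ffunP => l.
    by rewrite !ffunE.
  exact: vS vl.
rewrite -/q cS' big_distrr /= big_distrl /= -mulnA mulnCA -sum_nat_const.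
apply: leq_sum => -[y s] _ /=.
rewrite -(piC y) mulnA leq_mul2r; apply/orP; right; exact: S'X.
Qed.

End Counting.

(** A 2-cell of the quotient complex is encoded by the pair of its base vertex
    and the position of its relator in [ws]. *)
Definition touched_cells (G : groupType) (m : nat) (a : 'I_m -> G)
    (ws : seq (seq ('I_m * bool))) (Q : finGroupType)
    (rho : {multiplicative G -> Q}) (S : {set Q * 'I_m}) :
    {set Q * 'I_(size ws)} :=
  [set c : Q * 'I_(size ws) | has (fun e => (c.1 * rho e.1, e.2) \in S)
             (word_edges a 1 (nth [::] ws c.2))].

Definition total_length (I : Type) (ws : seq (seq I)) : nat :=
  (\sum_(w <- ws) size w)%N.

Section Touched.
Variables (G : groupType) (m : nat) (a : 'I_m -> G).
Variables (ws : seq (seq ('I_m * bool))) (Q : finGroupType).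
Variables (rho : {multiplicative G -> Q}) (S : {set Q * 'I_m}).

(** A letter of a relator together with the edge of [S] that it runs through
    determines the base vertex of the cell. *)
Lemma card_touched_cells :
  (#|touched_cells a ws rho S| <= total_length ws * #|S|)%N.
Proof.
have cardhas (r : seq (G * 'I_m)) :
    (#|[set y : Q | has (fun e => ((y * rho e.1)%g, e.2) \in S) r]|
     <= size r * #|S|)%N.
  elim: r => [|e r IH] /=; first by rewrite eq_card0 // => y; rewrite inE.
  rewrite (_ : [set _ | _] = [set y : Q | (y * rho e.1, e.2) \in S] :|:
     [set y : Q | has (fun e => (y * rho e.1, e.2) \in S) r]); last first.
    by apply/setP => y; rewrite !inE.
  apply: leq_trans (leq_card_setU _ _) _; rewrite mulSn leq_add //.
  have inj : injective (fun y => (y * rho e.1, e.2)).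
    by move=> y z [/mulIg].
  rewrite -(card_imset _ inj); apply/subset_leq_card/fintype.subsetP.
  by move=> _ /imsetP[y + ->]; rewrite inE.
pose X (r : 'I_(size ws)) := [set y : Q | (y, r) \in touched_cells a ws rho S].
have -> : #|touched_cells a ws rho S| = (\sum_r #|X r|)%N.
  rewrite -sum1_card (partition_big snd predT) //=; apply: eq_bigr => r _.
  rewrite -sum1_card (reindex_onto (fun y => (y, r)) fst) /=.
    by apply: eq_bigl => y; rewrite !inE /= !eqxx !andbT.
  by move=> [y r'] /= /andP[_ /eqP ->].
rewrite /total_length (big_nth [::]) big_mkord big_distrl /=.
apply: leq_sum => r _; rewrite -(size_word_edges a 1).
apply: leq_trans (cardhas _); apply: eq_leq; apply: eq_card => y.
by rewrite !inE.
Qed.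

Lemma not_touched_cells g (r : 'I_(size ws)) x s :
    (rho g, r) \notin touched_cells a ws rho S ->
    (x, s) \in word_edges a g (nth [::] ws r) -> (rho x, s) \notin S.
Proof.
rewrite inE => /hasPn nS; rewrite -[g]mulg1 word_edges_translate.
case/mapP => -[y t] yt [-> ->]; rewrite gmulfM.
exact: (nS _ yt).
Qed.

End Touched.

(** For potentials on D this says that their classes are linearly independent,
    in the form in which it is used. *)
Definition jointly_onto (p : nat) (G : groupType) (D : groupClosed G) (w : nat)
    (h : 'I_w -> G -> 'F_p) : Prop :=
  forall v : 'I_w -> 'F_p, exists2 t, t \in D & forall k, h k t = v k.

Definition supported (p : nat) (G : groupType) (m : nat) (a : 'I_m -> G)
    (Q : finGroupType) (rho : {multiplicative G -> Q}) (w : nat)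
    (h : 'I_w -> G -> 'F_p) (S : {set Q * 'I_m}) : Prop :=
  forall k g s, h k (g * a s) <> h k g -> (rho g, s) \in S.

Lemma independent_jointly_onto (p : nat) (G : groupType) (D : groupClosed G)
    (w : nat) (h : 'I_w -> G -> 'F_p) :
    (forall k, potential D (h k)) ->
    (forall beta, (forall t, t \in D -> (\sum_k beta k * h k t = 0)%R) ->
       forall k, beta k = 0%R) ->
  jointly_onto D h.
Proof.
move=> hD indep v.
pose P (u : 'I_w -> 'F_p) := exists2 t, t \in D & forall k, h k t = u k.
apply: (@Fp_closed_full p w P).
- by exists 1 => [|k]; rewrite ?gpred1 // (potential1 (hD k)).
- move=> u1 u2 [t1 t1D h1] [t2 t2D h2]; exists (t1 * t2); first exact: gpredM.
  by move=> k; rewrite (hD k) // h1 h2.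
- move=> beta b0; apply: indep => t tD; apply: (b0 (fun k => h k t)).
  by exists t.
Qed.

(** * Sparser classes on the next term of the series *)
Section Descent.
Variables (p : nat) (G : groupType) (m : nat) (a : 'I_m -> G).
Variable ws : seq (seq ('I_m * bool)).
Hypotheses (pp : prime p) (presG : presents a ws).
Variables (D : groupClosed G) (Q Q' : finGroupType).
Variables (rho : {multiplicative G -> Q}) (rho' : {multiplicative G -> Q'}).
Hypotheses (qD : finite_quotient D rho).
Hypotheses (qD' : finite_quotient (comm_pow p D) rho').
Variables (d w : nat) (f : 'I_d -> G -> 'F_p) (h : 'I_w -> G -> 'F_p).
Variable S : {set Q * 'I_m}.
Hypotheses (fD : forall j, potential D (f j)) (fF : jointly_onto D f).
Hypotheses (hD : forall k, potential D (h k)) (hF : jointly_onto D h).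
Hypothesis hS : supported a rho h S.
Hypothesis enough : (total_length ws * #|S| + w * w + w <= d * w)%N.

Let dh k g s : 'F_p := (h k (g * a s)%g - h k g)%R.

Let dhD k t g s : t \in D -> dh k (t * g)%g s = dh k g s.
Proof. by move=> tD; rewrite /dh -mulgA !(hD k _ tD) opprD addrACA subrr add0r. Qed.

(** The coefficients x_(j,k) of the cochains sum x_(j,k) f_j dh_k are subject to
    one closedness condition for each touched cell, and to the w^2 conditions
    sum_j x_(j,k) f_j(tt k') = 0, which will prevent the class from being
    trivial. *)
Lemma closed_combinations (tt : 'I_w -> G) :
  exists x : 'I_w -> 'I_d * 'I_w -> 'F_p,
  [/\ forall l r, r \in ws -> forall g, line_integral a
        (fun y s => \sum_i x l i * (f i.1 y * dh i.2 y s) : 'F_p)%R g r = 1,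
      forall l k k', (\sum_j x l (j, k) * f j (tt k'))%R = 0%R &
      forall beta : 'I_w -> 'F_p,
       (forall i, \sum_l beta l * x l i = 0)%R -> forall l, beta l = 0%R].
Proof.
have [sec secK] := choice (quot_surj qD).
pose T := ((Q * 'I_(size ws)) + ('I_w * 'I_w))%type.
pose A : {set T} := [set t : T |
  if t is inl c then c \in touched_cells a ws rho S else true].
pose c (t : T) (i : 'I_d * 'I_w) : 'F_p := match t with
  | inl u => line_integral a (fun y s => f i.1 y * dh i.2 y s : 'F_p)%R
               (sec u.1) (nth [::] ws u.2)
  | inr u => ((i.2 == u.1)%:R * f i.1 (tt u.2))%R
  end.
have cA : (#|A| + w <= #|{: 'I_d * 'I_w}|)%N.
  rewrite card_prod !card_ord; apply: leq_trans enough; rewrite leq_add2r.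
  have -> : A = [set inl u | u in touched_cells a ws rho S]
      :|: [set inr u | u in [set: 'I_w * 'I_w]].
    apply/setP => -[u|u]; rewrite !inE.
      rewrite mem_imset; last by move=> ? ? [].
      by rewrite inE orbC; case: imsetP => // -[].
    by rewrite orbC imset_f.
  apply: leq_trans (leq_card_setU _ _) _; apply: leq_add.
    by apply: leq_trans (leq_imset_card _ _) (card_touched_cells _ _ _ _).
  by apply: leq_trans (leq_imset_card _ _) _; rewrite cardsT card_prod !card_ord.
have [x [xA xI]] := independent_solutions c cA.
exists x; split=> //.
  move=> l r rws g.
  have rn : (index r ws < size ws)%N by rewrite index_mem.
  pose r' := Ordinal rn.
  have rE : r = nth [::] ws r' by rewrite nth_index.
  have gD : g / sec (rho g) \in D by apply/(quot_eq _ _ qD); rewrite secK.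
  (* Translation by D adds a combination of the exact cochains dh_k, so
     closedness has to be tested at one vertex in each coset only. *)
  pose sg := sec (rho g); pose t := g / sg.
  rewrite -[g](mulgVK sg) -line_integral_translate -/t.
  under [X in line_integral a X](_ : _ = fun y s =>
      (\sum_i x l i * (f i.1 y * dh i.2 y s)
       + \sum_i (x l i * f i.1 t) * dh i.2 y s)%R).
    apply/funext => y; apply/funext => s; rewrite -big_split.
    by apply: eq_bigr => i _; rewrite dhD // (fD i.1 _ gD) /=; ring.
  rewrite line_integralD [X in (_ + X)%R]line_integral_sum.
  rewrite [X in (_ + X)%R]big1 => [|i _]; last first.
    rewrite (line_integral_exact (H := h i.2)) => [|y s _].
      by rewrite (pres_rel presG) // mulg1 mulVg [1]/(0%R : 'F_p) mulr0.
    by rewrite /dh addrC.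
  rewrite addr0 -/sg.
  have [tch|ntch] := boolP ((rho g, r') \in touched_cells a ws rho S); last first.
    apply: line_integral_triv => y s ys; rewrite big1 // => i _.
    have rys : rho g = rho sg by rewrite secK.
    rewrite rE in ys; rewrite rys in ntch.
    have := not_touched_cells ntch ys.
    case: (eqVneq (h i.2 (y * a s)) (h i.2 y)) => [e _|/eqP ne].
      by rewrite /dh e subrr !mulr0.
    by rewrite (hS ne).
  rewrite line_integral_sum.
  have := xA l (inl (rho g, r')); rewrite inE => /(_ tch) E.
  rewrite -[RHS]E; apply: eq_bigr => i _.
  by rewrite /c /= -rE mulrC.
move=> l k k'.
have := xA l (inr (k, k')); rewrite inE => /(_ isT) E; rewrite -[RHS]E.
transitivity (\sum_j \sum_k0 c (inr (k, k')) (j, k0) * x l (j, k0))%R; last first.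
  by rewrite pair_bigA; apply: eq_bigr => -[].
apply: eq_bigr => j _; rewrite (bigD1 k) //= eqxx mul1r big1 ?addr0 1?mulrC //.
by move=> i /negbTE ->; rewrite !mul0r.
Qed.

(** The families h of D and h' of [D, D] D^p have the same number w of members,
    so the construction can be iterated, and the density of the support drops
    by the fixed factor 1 - p^(-w). *)
Lemma descent :
  exists (h' : 'I_w -> G -> 'F_p) (S' : {set Q' * 'I_m}),
  [/\ forall k, potential (comm_pow p D) (h' k), jointly_onto (comm_pow p D) h',
      supported a rho' h' S' &
      (p ^ w * #|S'| * #|Q| <= (p ^ w).-1 * #|S| * #|Q'|)%N].
Proof.
have /choice[tt ttP] : forall k : 'I_w, exists t, t \in D /\
    forall k', h k' t = (k' == k)%:R%R.
  by move=> k; have [t tD tk] := hF (fun k' => (k' == k)%:R%R); exists t.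
have [x [xcl xtt xI]] := closed_combinations tt.
pose F l k g : 'F_p := (\sum_j x l (j, k) * f j g)%R.
have FD l k : potential D (F l k) by exact: potential_lin.
have /choice[H HP] : forall l, exists H : G -> 'F_p, H 1 = 0%R /\
    forall g s, H (g * a s) = (H g + \sum_k F l k g * dh k g s)%R.
  move=> l; have [H H1 dH] := primitive_exists presG (xcl l).
  exists H; split=> // g s; rewrite dH -[LHS]/(_ + _)%R; congr (_ + _)%R.
  under [RHS]eq_bigr do rewrite big_distrl.
  rewrite exchange_big pair_bigA; apply: eq_bigr => -[j k] _ /=.
  by rewrite mulrA.
have H1 l := (HP l).1; have dH l := (HP l).2.
have HD' l : potential (comm_pow p D) (H l).
  exact: (twisted_potential pp presG hD (FD l) (H1 l) (dH l)).
have dHE l g s : (H l (g * a s)%g - H l g = \sum_k F l k g * dh k g s)%R.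
  by rewrite dH addrC addKr.
have HF : jointly_onto (comm_pow p D) H.
  apply: independent_jointly_onto HD' _ => beta b0; apply: xI => -[j k'].
  pose Fb k g : 'F_p := (\sum_l beta l * F l k g)%R.
  have FbD k : potential D (Fb k) by exact: potential_lin.
  have Hb1 : (\sum_l beta l * H l 1%g = 0)%R.
    by rewrite big1 // => l _; rewrite H1 mulr0.
  have dHb g s : (\sum_l beta l * H l (g * a s)%g
      = \sum_l beta l * H l g + \sum_k Fb k g * (h k (g * a s)%g - h k g))%R.
    under eq_bigr do rewrite dH mulrDr.
    rewrite big_split /=; congr (_ + _)%R.
    under eq_bigr do rewrite big_distrr /=.
    rewrite exchange_big /=; apply: eq_bigr => k _.
    by rewrite /Fb big_distrl /=; apply: eq_bigr => l _; rewrite mulrA.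
  (* Evaluate the symmetric form at the dual element tt k': one side is Fb k',
     and the other is zero by the choice of the coefficients. *)
  have sym := twisted_symmetric pp presG hD FbD Hb1 dHb b0.
  have [s sD fs] := fF (fun j' => (j' == j)%:R%R).
  have [tD tk] := ttP k'.
  have := sym s (tt k') sD tD.
  rewrite [LHS](bigD1 k') //= big1 => [|k /negbTE kk]; last first.
    by rewrite tk kk mulr0.
  rewrite tk eqxx mulr1 addr0 [RHS]big1 => [|k _]; last first.
    by rewrite /Fb big1 ?mul0r // => l _; rewrite /F xtt mulr0.
  move=> E; rewrite -[RHS]E; apply: eq_bigr => l _; congr (_ * _)%R.
  rewrite /F (bigD1 j) //= fs eqxx mulr1 big1 ?addr0 // => j' /negbTE jj.
  by rewrite fs jj mulr0.
have [||||S' S'P cS'] := @support_count _ _ _ _ _ _ _ qD qD' (@comm_pow_sub p G D) _ _ w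
    (fun l g s => \sum_k F l k g * dh k g s : 'F_p)%R S.
- move=> l t g s tD'; apply: eq_bigr => k _.
  have tD := comm_pow_sub tD'.
  by rewrite dhD // (FD l k _ _ tD) (potential_comm_pow pp (FD l k)) // add0r.
- move=> l u g g' s uD gg'; rewrite -!sumrB; apply: eq_bigr => k _.
  have gD : g / g' \in D by apply/(quot_eq _ _ qD).
  have dgg : dh k g s = dh k g' s by rewrite -[g](mulgVK g') dhD.
  by rewrite !dhD // !(FD l k _ _ uD) -dgg; ring.
- move=> y s; have [g gy] := quot_surj qD y.
  (* Every F l k is a combination of the f j, so they all vanish at t g. *)
  have [t tD ft] := fF (fun j => - f j g)%R.
  exists (t * g).
    by rewrite gmulfM gy; have /(quot_ker qD) -> := tD; rewrite mul1g.
  move=> l; rewrite big1 // => k _; rewrite /F big1 ?mul0r // => j _.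
  by rewrite (fD j) // ft addNr mulr0.
- move=> l g s vn0; apply: contrapT => nS; apply: vn0; rewrite big1 // => k _.
  rewrite /dh; case: (eqVneq (h k (g * a s)) (h k g)) => [->|/eqP/hS //].
  by rewrite subrr mulr0.
exists H, S'; split=> //; last by rewrite card_Fp in cS'.
move=> l g s ne; apply: (S'P l); rewrite -dHE => /eqP.
by rewrite subr_eq0 => /eqP.
Qed.

End Descent.

(** * The terms of the derived p-series *)

(** The group law is put on the finite set of cosets itself, through a choice of
    representatives. *)
Lemma finite_quotient_exists (G : groupType) (D : groupClosed G) :
    normal_subgroup D -> (0 < subgroup_index D)%N ->
  exists (Q : finGroupType) (rho : {multiplicative G -> Q}),
    finite_quotient D rho /\ #|Q| = subgroup_index D.
Proof.
move=> nD; rewrite /subgroup_index.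
have finC : (0 < #|` fset_set (left_cosets D)|)%N -> finite_set (left_cosets D).
  by rewrite /fset_set; case: pselect => // _; rewrite cardfs0.
move=> /[dup] /finC {}finC _.
pose X : finType := fset_set (left_cosets D).
pose coset_of (g : G) : set G := [set g * h | h in [set` D]]%classic.
have cosetX g : coset_of g \in fset_set (left_cosets D).
  by rewrite in_fset_set //; apply/mem_set; exists g.
pose kappa (g : G) : X := [` cosetX g]%fset.
have kappaE g g' : kappa g = kappa g' <-> g^-1 * g' \in D.
  split=> [/(congr1 val) /= E|gD].
    have [h hD <-] : coset_of g g'.
      by rewrite E; exists 1; rewrite ?mulg1 //=; exact: gpred1.
    by rewrite mulKg.
  apply: val_inj; apply/seteqP; split=> _ [h hD <-] /=.
    exists (g'^-1 * g * h); last by rewrite !mulgA mulgV mul1g.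
    by rewrite /= gpredM // -[X in X \in _]invgK invgM invgK gpredV.
  exists (g^-1 * g' * h); last by rewrite !mulgA mulgV mul1g.
  by rewrite /= gpredM.
have kappa_surj (x : X) : exists g, kappa g = x.
  have := valP x; rewrite in_fset_set // => /set_mem[g _ gx].
  by exists g; apply: val_inj.
have [sec secK] := choice kappa_surj.
have secD g : (sec (kappa g))^-1 * g \in D by apply/kappaE; rewrite secK.
pose mul x y := kappa (sec x * sec y).
have mulE g g' : mul (kappa g) (kappa g') = kappa (g * g').
  apply/kappaE; set x := sec _; set y := sec _.
  have -> : (x * y)^-1 * (g * g') = (x^-1 * g) ^ y * (y^-1 * g').
    by rewrite invgM conjgE !mulgA mulgK.
  by rewrite gpredM ?nD ?secD.
pose inv x := kappa (sec x)^-1.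
have mulA : associative mul.
  move=> x y z; rewrite -[x]secK -[y]secK -[z]secK !mulE; by rewrite mulgA.
have mul1 : left_id (kappa 1) mul.
  by move=> x; rewrite -[x]secK mulE mul1g.
have mulV : left_inverse (kappa 1) inv mul.
  by move=> x; rewrite /inv -[X in mul _ X]secK mulE mulVg.
pose Q : finGroupType :=
  HB.pack_for finGroupType (Finite.sort X) (Finite_isGroup.Build X mulA mul1 mulV).
have kappaM : {morph (kappa : G -> Q) : x y / x * y}.
  by move=> x y; exact: (esym (mulE x y)).
pose rho := HB.pack_for {multiplicative G -> Q} (kappa : G -> Q)
   (isMultiplicative.Build G Q kappa kappaM).
exists Q, rho; split.
  split=> [y|g]; first exact: kappa_surj.
  rewrite -[rho g]/(kappa g) -[1]/(kappa 1).
  by rewrite kappaE mulg1; split; rewrite gpredV.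
by rewrite -[LHS]/(#|X|) cardfE.
Qed.

(** The first homology of the bar complex is dual to the characters: a basis of
    homology gives coordinates of the 1-cells, and the boundaries of the 2-cells
    say that these coordinates are additive. *)
Section Homology.
Variables (p : nat) (H : groupType).
Local Open Scope ring_scope.
Local Notation chains := {freeg H / 'F_p}.
Local Notation bdry := (range (@bar_d2 'F_p H)).
Local Notation cell g := ([freeg [:: (1, g)]] : chains).

Lemma bdryB x y : bdry x -> bdry y -> bdry (x - y).
Proof.
move=> [c _ <-] [e _ <-]; exists (c - e) => //.
by rewrite /bar_d2 lift_is_additive.
Qed.

Lemma bdry0 : bdry 0.
Proof.
exists 0 => //; rewrite -(subrr (0 : {freeg (H * H) / 'F_p})).
by rewrite /bar_d2 lift_is_additive subrr.
Qed.

Lemma bdryD x y : bdry x -> bdry y -> bdry (x + y).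
Proof.
move=> bx bY; rewrite -[y]opprK; apply: bdryB => //.
by rewrite -[- y]add0r; apply: bdryB => //; exact: bdry0.
Qed.

Lemma bdry_mul g h : bdry (cell h - cell (g * h)%g + cell g).
Proof.
by exists [freeg [:: (1, (g, h))]] => //; rewrite /bar_d2 liftU scale1r.
Qed.

Lemma bar_d1_eq0 (c : chains) : bar_d1 c = 0.
Proof.
rewrite -[c]freeg_repr /bar_d1 fglift_Freeg /prelift big1 // => x _.
by rewrite subrr scaler0.
Qed.

Lemma homology_characters (n : nat) :
    is_quotient_dim [set c | @bar_d1 'F_p H c = 0]%classic bdry n ->
  exists u : 'I_n -> H -> 'F_p,
    (forall j x y, u j (x * y)%g = u j x + u j y) /\
    (forall v : 'I_n -> 'F_p, exists x, forall j, u j x = v j).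
Proof.
move=> [c [_ indep span]].
have /choice[coef coefP] : forall z : chains, exists a : 'I_n -> 'F_p,
    bdry (z - \sum_i a i *: c i).
  by move=> z; apply: span; exact: bar_d1_eq0.
have coefU z a : bdry (z - \sum_i a i *: c i) -> coef z =1 a.
  move=> za i; apply/eqP; rewrite -subr_eq0; apply/eqP.
  apply: (indep (fun i => coef z i - a i)).
  have -> : \sum_i (coef z i - a i) *: c i
      = (z - \sum_i a i *: c i) - (z - \sum_i coef z i *: c i).
    rewrite opprB addrC subrKA -sumrB.
    by apply: eq_bigr => j _; rewrite scalerBl.
  by apply: bdryB.
have coefD y z i : coef (y + z) i = coef y i + coef z i.
  apply: (coefU (y + z) (fun i => coef y i + coef z i)).
  have -> : \sum_i (coef y i + coef z i) *: c i
      = \sum_i coef y i *: c i + \sum_i coef z i *: c i.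
    by rewrite -big_split; apply: eq_bigr => j _; rewrite scalerDl.
  by rewrite opprD addrACA; apply: bdryD.
have coef0 z i : bdry z -> coef z i = 0.
  move=> bz; apply: (coefU z (fun=> 0)).
  by rewrite big1 ?subr0 // => j _; rewrite scale0r.
have coefM x y j : coef (cell (x * y)%g) j = coef (cell x) j + coef (cell y) j.
  have := coefD (cell y - cell (x * y)%g + cell x) (cell (x * y)%g) j.
  rewrite (coef0 _ _ (bdry_mul x y)) add0r => <-.
  by rewrite addrAC subrK addrC coefD.
have coef1 j : coef (cell 1%g) j = 0.
  by apply: coef0; have := bdry_mul 1%g 1%g; rewrite mulg1 subrr add0r.
have coefX x k j : coef (cell (x ^+ k)%g) j = coef (cell x *+ k) j.
  elim: k => [|k IH]; first by rewrite expg0 coef1 mulr0n coef0 //; exact: bdry0.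
  by rewrite expgS coefM IH mulrS coefD.
have freeP (s : seq ('F_p * H)) :
    exists x, forall j, coef (cell x) j = coef [freeg s] j.
  elim: s => [|[k x] s [y yE]].
    by exists 1%g => j; rewrite freeg_nil coef1 coef0 //; exact: bdry0.
  exists (x ^+ k * y)%g => j.
  rewrite coefM coefX freegU_muln natr_Zp yE -coefD.
  by rewrite -freeg_cat.
exists (fun j x => coef (cell x) j); split=> [j x y|v]; first exact: coefM.
pose z := \sum_i v i *: c i.
have [x xE] := freeP (fgenum z).
exists x => j; rewrite xE (Freeg_enum z) (coefU z v) // subrr; exact: bdry0.
Qed.

End Homology.

(** A character of D extends to a potential through representatives of the
    cosets of D. *)
Lemma homology_potentials (p : nat) (G : groupType) (D : groupClosed G)
    (Q : finGroupType) (rho : {multiplicative G -> Q}) :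
    finite_quotient D rho ->
  exists f : 'I_(d_p p (subgroup_type D)) -> G -> 'F_p,
    (forall j, potential D (f j)) /\ jointly_onto D f.
Proof.
move=> qD; rewrite /d_p /quotient_dim; set P := [set n | _]%classic.
have [n _ /homology_characters [u [uM uF]]|_] := xgetP 0%N P; last first.
  exists (fun=> fun=> 0%R); split=> [[]//|v].
  by exists 1 => [|[]//]; exact: gpred1.
have [sec secK] := choice (quot_surj qD).
pose iD := insubd (1 : subgroup_type D).
pose f0 j g := u j (iD (g / sec (rho g))).
have vD x : x \in D -> val (iD x) = x by move=> xD; rewrite /iD insubdK.
have secD g : g / sec (rho g) \in D by apply/(quot_eq _ _ qD); rewrite secK.
have f0D j t g : t \in D -> f0 j (t * g) = (u j (iD t) + f0 j g)%R.
  move=> tD; rewrite /f0 -uM; congr (u j _); apply: val_inj.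
  have tg : rho (t * g) = rho g.
    by rewrite gmulfM; have /(quot_ker qD) -> := tD; rewrite mul1g.
  have tgD : t * g / sec (rho g) \in D by rewrite -mulgA gpredM.
  by rewrite (valM _ _ : _ = _ :> G) tg !vD // mulgA.
pose f j g := (f0 j g - f0 j 1%g)%R.
have fu j t : t \in D -> f j t = u j (iD t).
  by move=> tD; rewrite /f -[t in LHS]mulg1 f0D // addrK.
exists f; split=> [j t g tD|v].
  by rewrite (fu _ _ tD) /f f0D // addrA.
have [x xv] := uF v; exists (val x); first exact: valP.
have xD : val x \in D := valP x.
by move=> k; rewrite fu // -(xv k); congr (u k _); apply: val_inj; exact: vD.
Qed.

Lemma generated_normal (G : groupType) (A : set G) :
    (forall x g, A x -> A (x ^ g)) -> normal_subgroup (generated_subgroup A).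
Proof.
move=> AJ x g.
have cl : group_closed
    ((fun y => `[< y ^ g \in generated_subgroup A >]) : {pred G}).
  split=> [|y z /asboolP yA /asboolP zA]; apply/asboolP.
    by rewrite conj1g gpred1.
  by rewrite conjMg conjVg gpredF.
move=> xA; suff : x \in to_subgroup cl by move/asboolP.
by apply: generated_sub xA => y Ay; apply/asboolP/mem_generated/AJ.
Qed.

Lemma comm_pow_normal (p : nat) (G : groupType) (D : groupClosed G) :
  normal_subgroup D -> normal_subgroup (comm_pow p D).
Proof.
move=> nD z g /asboolP[x [y [xC yP ->]]].
apply/asboolP; exists (x ^ g), (y ^ g); rewrite conjMg; split=> //.
  apply: generated_normal xC => _ h [s /= sD [t /= tD <-]].
  by exists (s ^ h); [exact: nD | exists (t ^ h); [exact: nD | rewrite conjRg]].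
apply: generated_normal yP => _ h [s /= sD <-].
by exists (s ^ h); [exact: nD | rewrite conjXg].
Qed.

Lemma derived_p_series_normal (p : nat) (G : groupType) i :
  normal_subgroup (derived_p_series p G i).
Proof. by elim: i => [|i IH] //=; exact: comm_pow_normal. Qed.

Lemma derived_p_series_exp (p : nat) (G : groupType) i (g : G) :
  g ^+ (p ^ i) \in derived_p_series p G i.
Proof.
elim: i => [|i IH] //=; rewrite expnSr expgnA.
apply/asboolP; exists 1, (g ^+ (p ^ i) ^+ p); rewrite mul1g gpred1; split=> //.
by apply: mem_generated; exists (g ^+ (p ^ i)).
Qed.

(** By Cauchy's theorem every prime divisor of the order is the order of an
    element. *)
Lemma p_power_order (p e : nat) (Q : finGroupType) :
    prime p -> (forall y : Q, y ^+ (p ^ e) = 1) -> exists k, #|Q| = (p ^ k)%N.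
Proof.
move=> pp Qe.
have : pgroup.pgroup p [set: Q].
  apply/pgroup.pgroupP => q qp qQ.
  have [y _ yq] := pgroup.Cauchy qp qQ.
  have : (q %| p ^ e)%N by rewrite -yq cyclic.order_dvdn Qe eqxx.
  by rewrite Euclid_dvdX // dvdn_prime2 // => /andP[].
by move/p_natP => [k kE]; exists k; rewrite -kE cardsT.
Qed.

Lemma derived_p_series_quotient (p : nat) (G : groupType) i :
    prime p -> (0 < subgroup_index (derived_p_series p G i))%N ->
  exists (Q : finGroupType) (rho : {multiplicative G -> Q}),
    [/\ finite_quotient (derived_p_series p G i) rho,
        #|Q| = subgroup_index (derived_p_series p G i) &
        exists k, #|Q| = (p ^ k)%N].
Proof.
move=> pp /(finite_quotient_exists (@derived_p_series_normal p G i)).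
move=> [Q [rho [qD cQ]]]; exists Q, rho; split=> //.
apply: (p_power_order (e := i) pp) => y.
have [g <-] := quot_surj qD y.
by rewrite -morphX; apply/(quot_ker qD)/derived_p_series_exp.
Qed.

Lemma derived_p_series_sub p (G : groupType) i :
  {subset derived_p_series p G i.+1 <= derived_p_series p G i}.
Proof. exact: comm_pow_sub. Qed.

(** A positive infimum excludes the value 0 by which infinite indices are
    encoded, so all indices are finite. *)
Lemma linear_growth_bound (R : realType) (p : nat) (G : groupType)
    (S : nat -> groupClosed G) :
  linear_growth R p S -> exists M : nat, forall i,
    (0 < subgroup_index (S i) <= M * d_p p (subgroup_type (S i)))%N.
Proof.
rewrite /linear_growth; set A := (X in reals.inf X) => A0.
have Ai i : (inf A <= (d_p p (subgroup_type (S i)))%:R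
                      / (subgroup_index (S i))%:R)%R.
  apply: ge_inf; last by exists i.
  by exists 0%R => _ [j _ <-]; rewrite divr_ge0.
exists (Num.bound (inf A)^-1) => i; move: (Ai i).
set n := subgroup_index _; set d := d_p _ _ => Ain.
have n0 : (0 < n)%N.
  rewrite lt0n; apply/eqP => nE; move: Ain; rewrite nE invr0 mulr0.
  by rewrite leNgt A0.
rewrite n0 /= -(ler_nat R) natrM.
move: Ain; rewrite ler_pdivlMr ?ltr0n // => Ain.
have : (n%:R <= d%:R / inf A :> R)%R by rewrite ler_pdivlMr // mulrC.
move=> /le_trans; apply; rewrite mulrC ler_wpM2r //.
have := archi_boundP (ltW (_ : 0 < (inf A)^-1)%R); rewrite invr_gt0 => /(_ A0).
exact: ltW.
Qed.

(** * Classes transverse to a sparse one *)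

Section Transversal.
Variables (G : groupType) (m : nat) (a : 'I_m -> G).
Variable ws : seq (seq ('I_m * bool)).
Hypothesis presG : presents a ws.
Variables (Q : finGroupType) (rho : {multiplicative G -> Q}).
Hypothesis rho_surj : forall y, exists g, rho g = y.

(** The lifted vertices [rep y], [y] in [X], span a connected subgraph of the
    Cayley graph, expressed as an induction principle: a property that holds at
    1 and is transported along the edges between lifted vertices holds at all of
    them. For X the whole quotient this is a Schreier transversal. *)
Definition tree_connected (X : {set Q}) (rep : Q -> G) : Prop :=
  forall P : G -> Prop, P 1 ->
    (forall g s, rho g \in X -> rho (g * a s) \in X -> rep (rho g) = g ->
       rep (rho (g * a s)) = g * a s -> (P g <-> P (g * a s))) ->
  forall y, y \in X -> P (rep y).

(** Unless [X] is everything, connectedness gives an edge that leaves [X]; lift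
    its far end next to the lift of its near end. *)
Lemma tree_grow (X : {set Q}) (rep : Q -> G) :
    1 \in X -> (forall y, y \in X -> rho (rep y) = y) -> rep 1 = 1 ->
    tree_connected X rep -> X != [set: Q] ->
  exists (y : Q) (rep' : Q -> G),
    [/\ y \notin X, forall z, z \in y |: X -> rho (rep' z) = z, rep' 1 = 1 &
        tree_connected (y |: X) rep'].
Proof.
move=> X1 repK rep1 repT XnT.
have [z [g' [zX g'X step]]] : exists z g', [/\ z \in X, rho g' \notin X &
    exists s, g' = rep z * a s \/ rep z = g' * a s].
  apply: contrapT => nex; case/eqP: XnT; apply/setP => z; rewrite inE.
  have [g <-] := rho_surj z; move: g; apply: (pres_ind presG).
    by rewrite morph1 X1.
  move=> g s; rewrite gmulfM; split=> /= gX.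
    apply: contrapT => ngX; apply: nex; exists (rho g), (rep (rho g) * a s).
    rewrite gmulfM repK //; split=> //; first exact/negP.
    by exists s; left.
  apply: contrapT => ngX; apply: nex; exists (rho g * rho (a s)).
  exists (rep (rho g * rho (a s)) / a s).
  rewrite morphF repK // mulgK; split=> //; first exact/negP.
  by exists s; right; rewrite mulgVK.
pose rep' y := if y == rho g' then g' else rep y.
have rep'X y : y \in X -> rep' y = rep y.
  by rewrite /rep'; case: eqP => // ->; rewrite (negbTE g'X).
have rep'g : rep' (rho g') = g' by rewrite /rep' eqxx.
exists (rho g'), rep'; split=> //.
- by move=> y /setU1P[->|yX]; rewrite ?rep'g // rep'X // repK.
- by rewrite rep'X.
move=> P P1 PS.
have PX y : y \in X -> P (rep y).
  apply: repT => // g s gX gsX gr gsr.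
  by apply: PS; rewrite ?inE ?gX ?gsX ?orbT // rep'X.
move=> y /setU1P[->|yX]; last by rewrite rep'X //; exact: PX.
rewrite rep'g; have := PX _ zX.
have zz : rho (rep z) \in rho g' |: X by rewrite repK // inE zX orbT.
have rz : rep' (rho (rep z)) = rep z by rewrite repK // rep'X.
have gg : rho g' \in rho g' |: X by rewrite setU11.
case: step => s [E|E] Pz.
  by rewrite E; apply/(PS (rep z) s); rewrite -?E.
by apply/(PS g' s); rewrite -?E.
Qed.

Lemma tree_transversal : exists rep : Q -> G,
  [/\ forall y, rho (rep y) = y, rep 1 = 1 & tree_connected [set: Q] rep].
Proof.
suff H n : (n < #|Q|)%N -> exists (X : {set Q}) (rep : Q -> G),
    [/\ #|X| = n.+1, 1 \in X, forall y, y \in X -> rho (rep y) = y, rep 1 = 1 &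
        tree_connected X rep].
  have Qpos : (0 < #|Q|)%N by apply/card_gt0P; exists 1.
  have Q0 : (#|Q|.-1 < #|Q|)%N by rewrite prednK.
  have [X [rep [cX _ repK rep1 repT]]] := H _ Q0.
  have XT : X = [set: Q].
    by apply/eqP; rewrite eqEcard finset.subsetT cardsT cX prednK /=.
  move: repK repT; rewrite XT => repK repT.
  by exists rep; split=> // y; apply: repK; rewrite inE.
elim: n => [_|n IH nQ].
  exists [set 1], (fun=> 1); split=> //; rewrite ?cards1 ?inE //.
    by move=> y /set1P ->; rewrite morph1.
have [X [rep [cX X1 repK rep1 repT]]] := IH (ltnW nQ).
have XnT : X != [set: Q].
  by apply: contraTneq nQ => XT; rewrite -cX XT cardsT ltnn.
have [y [rep' [yX rep'K rep'1 rep'T]]] := tree_grow X1 repK rep1 repT XnT.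
by exists (y |: X), rep'; split=> //; rewrite ?cardsU1 ?yX ?cX // inE X1 orbT.
Qed.
End Transversal.

Section Near.
Variables (G : groupType) (m : nat) (a : 'I_m -> G).
Variables (ws : seq (seq ('I_m * bool))) (Q : finGroupType).
Variables (rho : {multiplicative G -> Q}) (S : {set Q * 'I_m}).

(** [S] has to be added because its edges may lie on no cell. *)
Definition near_edges : {set Q * 'I_m} := S :|:
  \bigcup_(c in touched_cells a ws rho S)
    [set e | e \in
      [seq (c.1 * rho e.1, e.2) | e <- word_edges a 1 (nth [::] ws c.2)]].

Lemma card_near_edges :
  (#|near_edges| <= (total_length ws * total_length ws).+1 * #|S|)%N.
Proof.
apply: leq_trans (leq_card_setU _ _) _; rewrite mulSn leq_add2l.
pose F (c : Q * 'I_(size ws)) : {set Q * 'I_m} := [set e | e \in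
  [seq ((c.1 * rho e.1)%g, e.2) | e <- word_edges a 1 (nth [::] ws c.2)]].
apply: (@leq_trans (\sum_(c in touched_cells a ws rho S) #|F c|)%N).
  elim/big_rec2: _ => [|c n X _ IH]; first by rewrite cards0.
  by apply: leq_trans (leq_card_setU _ _) _; rewrite leq_add2l.
rewrite -mulnA (mulnC (total_length ws) (total_length ws * _)%N).
apply: (@leq_trans (#|touched_cells a ws rho S| * total_length ws)%N); last first.
  by rewrite leq_mul2r card_touched_cells orbT.
rewrite -sum_nat_const; apply: leq_sum => c _.
rewrite /F cardsE; apply: leq_trans (card_size _) _.
rewrite size_map size_word_edges /total_length (big_nth [::]) big_mkord.
by rewrite (bigD1 c.2) //= leq_addr.
Qed.

Lemma near_touched_cells g (r : 'I_(size ws)) x s :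
    (rho g, r) \in touched_cells a ws rho S ->
    (x, s) \in word_edges a g (nth [::] ws r) -> (rho x, s) \in near_edges.
Proof.
move=> gT; rewrite -[g]mulg1 word_edges_translate => /mapP[e ee [-> ->]].
apply/setUP; right; apply/bigcupP; exists (rho g, r) => //.
by rewrite inE gmulfM; apply/mapP; exists e.
Qed.

Lemma sub_near : {subset S <= near_edges}.
Proof. by move=> e eS; rewrite inE eS. Qed.
End Near.

Section TransverseFamily.
Variables (p : nat) (G : groupType) (m : nat) (a : 'I_m -> G).
Variables (D : groupClosed G) (Q : finGroupType) (rho : {multiplicative G -> Q}).
Hypothesis qD : finite_quotient D rho.
Variable rep : Q -> G.
Hypotheses (repK : forall y, rho (rep y) = y) (rep1 : rep 1 = 1).

(** Each class on D has a unique representative that vanishes on the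
    transversal. For these representatives, vanishing on the edges of [N] and at
    [d0] are #|N| + 1 linear conditions on d coefficients, so [n] independent
    ones survive. *)
Lemma transverse_family (d n : nat) (f : 'I_d -> G -> 'F_p)
    (N : {set Q * 'I_m}) (d0 : G) :
    (forall j, potential D (f j)) -> jointly_onto D f -> d0 \in D ->
    (#|N| + 1 + n <= d)%N ->
  exists phi : 'I_n -> G -> 'F_p,
    [/\ forall l, potential D (phi l), jointly_onto D phi,
        forall l y, phi l (rep y) = 0%R, forall l, phi l d0 = 0%R &
        forall l g s, (rho g, s) \in N -> phi l (g * a s) = phi l g].
Proof.
move=> fD fF d0D cN.
pose ph j g : 'F_p := (f j g - f j (rep (rho g)))%R.
have phD j : potential D (ph j).
  have phd t : t \in D -> ph j t = f j t.
    move=> tD; rewrite /ph; have /(quot_ker qD) -> := tD.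
    by rewrite rep1 (potential1 (fD j)) subr0.
  move=> t g tD; rewrite (phd t tD) /ph gmulfM; have /(quot_ker qD) -> := tD.
  by rewrite mul1g (fD j) // addrA.
pose A : {set option (Q * 'I_m)} := None |: [set Some e | e in N].
pose c (t : option (Q * 'I_m)) (j : 'I_d) : 'F_p :=
  if t is Some e then (ph j (rep e.1 * a e.2)%g - ph j (rep e.1))%R else ph j d0.
have cA : (#|A| + n <= #|{: 'I_d}|)%N.
  rewrite card_ord; apply: leq_trans cN; rewrite leq_add2r.
  apply: leq_trans (leq_card_setU _ _) _.
  by rewrite cards1 addnC leq_add2r leq_imset_card.
have [x [xA xI]] := independent_solutions c cA.
pose phi l g : 'F_p := (\sum_j x l j * ph j g)%R.
have phiD l : potential D (phi l) by exact: potential_lin.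
exists phi; split=> //.
- apply: independent_jointly_onto phiD _ => beta b0; apply: xI => j.
  have [t tD ft] := fF (fun j' => (j' == j)%:R%R).
  rewrite -[RHS](b0 t tD); apply: eq_bigr => l _; congr (_ * _)%R.
  have pht j' : ph j' t = (j' == j)%:R%R.
    rewrite /ph; have /(quot_ker qD) -> := tD.
    by rewrite rep1 (potential1 (fD j')) subr0 ft.
  rewrite /phi (bigD1 j) //= pht eqxx mulr1 big1 ?addr0 // => j' /negbTE jj.
  by rewrite pht jj mulr0.
- by move=> l y; rewrite /phi big1 // => j _; rewrite /ph repK subrr mulr0.
- move=> l; have /(xA l) <- : None \in A by rewrite setU11.
  by apply: eq_bigr => j _; rewrite mulrC.
move=> l g s gN.
have gD : g / rep (rho g) \in D by apply/(quot_eq _ _ qD); rewrite repK.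
rewrite -[g](mulgVK (rep (rho g))) -mulgA !(phiD l _ _ gD); congr (_ + _)%R.
have /(xA l) : Some (rho g, s) \in A by rewrite inE imset_f ?orbT.
move=> E; apply/eqP; rewrite -subr_eq0 -E -sumrB; apply/eqP.
by apply: eq_bigr => j _; rewrite /c /= -mulrBr mulrC.
Qed.

(** The elements [rep y * a s / rep (y * rho (a s))] are the Schreier generators
    of D. *)
Lemma schreier_potential ws (h : G -> 'F_p) : presents a ws -> potential D h ->
    (forall y s, h (rep y * a s / rep (y * rho (a s))) = 0%R) ->
  forall t, t \in D -> h t = 0%R.
Proof.
move=> presG hD h0.
have hrep g : h g = h (rep (rho g)).
  move: g; apply: (pres_ind presG) => [|g s].
    by rewrite morph1 rep1.
  set r := rep (rho g); set r' := rep (rho (g * a s)).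
  have gD : g / r \in D by apply/(quot_eq _ _ qD); rewrite repK.
  have sD : r * a s / r' \in D.
    by apply/(quot_eq _ _ qD); rewrite repK !gmulfM repK.
  have -> : h g = (h (g / r)%g + h r)%R by rewrite -(hD _ _ gD) mulgVK.
  have -> : h (g * a s) = (h (g / r)%g + h r')%R.
    have {1}-> : g * a s = g / r * ((r * a s / r') * r').
      by rewrite mulgVK !mulgA mulgVK.
    rewrite (hD _ _ gD) (hD _ _ sD).
    by have := h0 (rho g) s; rewrite -gmulfM -/r -/r' => ->; rewrite add0r.
  split=> [/eqP|/eqP]; rewrite -subr_eq0 addrK => /eqP ->; exact: add0r.
move=> t tD; rewrite hrep; have /(quot_ker qD) -> := tD.
by rewrite rep1 (potential1 hD).
Qed.
End TransverseFamily.

(** * The free quotient *)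
Section VertexLabel.
Variables (p : nat) (F : groupType) (m : nat) (b : 'I_m -> F).

(** The kernel of the projection of the free product of Z/p and (Z/p)^m to
    Z/p x (Z/p)^m is the fundamental group of a graph on the elements (x, v) of
    the target. This function u gives a map from it to F: a step from (x, v) to
    (x', v) contributes u(x,v)^-1 u(x',v), and a step along the second factor
    contributes 1. *)
Definition vertex_label (x : 'F_p) (v : 'rV['F_p]_m) : F :=
  if x == 0%R then
    if [pick j | v == delta_mx 0%R j] is Some j then b j else 1
  else 1.

Lemma vertex_label0 : vertex_label 0%R 0%R = 1.
Proof.
rewrite /vertex_label eqxx; case: pickP => // j /eqP/rowP/(_ j).
by rewrite !mxE !eqxx => /esym/eqP; rewrite oner_eq0.
Qed.

Lemma vertex_label_delta j : vertex_label 0%R (delta_mx 0%R j) = b j.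
Proof.
rewrite /vertex_label eqxx; case: pickP => [i /eqP/rowP/(_ j)|/(_ j)].
  by rewrite !mxE !eqxx /=; case: eqVneq => [->//|_ /eqP]; rewrite oner_eq0.
by rewrite eqxx.
Qed.

Lemma vertex_label1 v : vertex_label 1%R v = 1.
Proof. by rewrite /vertex_label oner_eq0. Qed.

End VertexLabel.

(** The class [h] is sparse and supported in [S], the classes [phi] vanish near
    [S] and on the transversal, and [d0] is a Schreier generator of D that is
    seen by [h] and not by [phi]. *)
Section FreeQuotient.
Variables (p : nat) (G F : groupType) (m : nat) (b : 'I_m -> F).
Variables (q : {multiplicative F -> G}) (ws : seq (seq ('I_m * bool))).
Hypotheses (pp : prime p) (genF : forall x, exists w, x = word_val b w).
Let a := q \o b.
Hypothesis presG : presents a ws.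
Variables (D : groupClosed G) (Q : finGroupType) (rho : {multiplicative G -> Q}).
Hypothesis qD : finite_quotient D rho.
Variable rep : Q -> G.
Hypothesis repK : forall y, rho (rep y) = y.
Hypothesis repT : tree_connected a rho [set: Q] rep.
Variables (S : {set Q * 'I_m}) (h : G -> 'F_p) (phi : 'I_m -> G -> 'F_p).
Hypothesis hD : potential D h.
Hypothesis hS : forall g s, h (g * a s) <> h g -> (rho g, s) \in S.
Hypotheses (phiD : forall l, potential D (phi l)) (phiF : jointly_onto D phi).
Hypothesis phirep : forall l y, phi l (rep y) = 0%R.
Hypothesis phinear : forall l g s, (rho g, s) \in near_edges a ws rho S ->
  phi l (g * a s) = phi l g.
Variable d0 : G.
Hypotheses (d0D : d0 \in D) (hd0 : h d0 <> 0%R) (phid0 : forall l, phi l d0 = 0%R).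
Variables (y0 : Q) (s0 : 'I_m).
Hypothesis d0E : d0 = rep y0 * a s0 / rep (y0 * rho (a s0)).

Let D' := comm_pow p D.
Let D'D t : t \in D' -> t \in D.
Proof. exact: comm_pow_sub. Qed.

Let vphi g : 'rV['F_p]_m := (\row_l phi l g)%R.

Let vphiD t g : t \in D -> vphi (t * g) = (vphi t + vphi g)%R.
Proof. by move=> tD; apply/rowP => l; rewrite !mxE (phiD l _ tD). Qed.

Let U g := vertex_label b (h g) (vphi g).

Let UE g g' : h g = h g' -> vphi g = vphi g' -> U g = U g'.
Proof. by rewrite /U => -> ->. Qed.

Let lab g s := if (rho g, s) \in S then (U g)^-1 * U (g * a s) else 1.

Let vphinear g s :
  (rho g, s) \in near_edges a ws rho S -> vphi (g * a s) = vphi g.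
Proof. by move=> gs; apply/rowP => l; rewrite !mxE phinear. Qed.

(** No cell meets both the support of [h] and that of [phi]. On a cell meeting
    [S], [phi] is constant and the labels are the coboundary of [U]; this also
    holds on the edges outside [S], where [h] is constant too. *)
Let lab_closed w : w \in ws -> forall g, line_integral a lab g w = 1.
Proof.
move=> wws g.
have wn : (index w ws < size ws)%N by rewrite index_mem.
pose r := Ordinal wn.
have wE : w = nth [::] ws r by rewrite nth_index.
have [gT|gnT] := boolP ((rho g, r) \in touched_cells a ws rho S).
  rewrite (line_integral_exact (H := U)).
    by rewrite (pres_rel presG) // mulg1 mulVg.
  move=> x s; rewrite {1}wE => /(near_touched_cells gT) xN.
  rewrite /lab; case: ifPn => // xS.
  rewrite (_ : U (x * a s) = U x) ?mulVg //; apply: UE.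
    by apply: contrapT => /hS xS'; rewrite xS' in xS.
  exact: vphinear.
apply: line_integral_triv => x s; rewrite {1}wE => /(not_touched_cells gnT).
by rewrite /lab => /negbTE ->.
Qed.

(** In the free product of Z/p and (Z/p)^m let alpha and beta come from the two
    factors. A path for alpha crosses only h, so it multiplies Om by
    U(start)^-1 U(end); a path for beta crosses only phi, and leaves Om
    unchanged. Hence alpha beta alpha^-1 beta^-1, with h(alpha) = 1 and
    phi(beta) = e_j, has image
    u(0,0)^-1 u(1,0) u(1,e_j)^-1 u(0,e_j) = b_j. If F were commutative, so would
    be G, these commutators would be trivial and so would the b_j, then F, G and
    the class of h. *)
Lemma free_quotient_of_comm_pow :
  exists f : {multiplicative subgroup_type D' -> F},
    (forall y, exists x, f x = y) /\ ~ (forall x y : F, commute x y).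
Proof.
have [Om Om1 dOm] := primitive_exists presG lab_closed.
have UD' n g : n \in D' -> U (n * g) = U g.
  move=> nD'; have nD := D'D nD'; apply: UE.
    by rewrite (hD _ nD) (potential_comm_pow pp hD) // add0r.
  rewrite vphiD //; apply/rowP => l; rewrite !mxE.
  by rewrite (potential_comm_pow pp (phiD l)) // add0r.
have OmD' n g : n \in D' -> Om (n * g) = Om n * Om g.
  move=> nD'; have nD := D'D nD'.
  have rn x : rho (n * x) = rho x.
    by rewrite gmulfM; have /(quot_ker qD) -> := nD; rewrite mul1g.
  move: g; apply: (pres_ind presG) => [|g s]; first by rewrite Om1 !mulg1.
  have labn : lab (n * g) s = lab g s.
    rewrite /lab rn -mulgA.
    by rewrite !(UD' _ _ nD').
  rewrite mulgA !dOm labn mulgA; split=> [->//|]; exact: mulIg.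
(* Lam is constant along edges on which phi is constant, and Om along edges on
   which h is constant. *)
pose Lam g := Om g / U g.
have OmE g : Om g = Lam g * U g by rewrite /Lam mulgVK.
have LamE g s : vphi (g * a s) = vphi g -> Lam (g * a s) = Lam g.
  move=> vE; rewrite /Lam dOm /lab; case: ifPn => gS.
    by rewrite !mulgA mulgK.
  rewrite mulg1 (_ : U (g * a s) = U g) //; apply: UE => //.
  by apply: contrapT => /hS gS'; rewrite gS' in gS.
have OmS g s : h (g * a s) = h g -> Om (g * a s) = Om g.
  move=> hE; rewrite dOm /lab; case: ifPn => gS; last by rewrite mulg1.
  rewrite (_ : U (g * a s) = U g) ?mulVg ?mulg1 //; apply: UE => //.
  by apply/vphinear/sub_near.
have vrep y : vphi (rep y) = 0%R by apply/rowP => l; rewrite !mxE phirep.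
have Lamrep y t : t \in D -> Lam (t * rep y) = Lam t.
  move: t; apply: (repT (P := fun g => forall t, t \in D -> Lam (t * g) = Lam t)).
  - by move=> t _; rewrite mulg1.
  - move=> g s _ _ gr gsr.
    have E t : t \in D -> Lam (t * (g * a s)) = Lam (t * g).
      move=> tD; rewrite mulgA; apply: LamE.
      have vg : vphi g = 0%R by rewrite -gr vrep.
      have vgs : vphi (g * a s) = 0%R by rewrite -gsr vrep.
      by rewrite -mulgA !(vphiD _ tD) vg vgs.
    by split=> H t tD; rewrite -(H t tD) E.
  - by rewrite inE.
(* PA: elements that act like the factor Z/p; PB: elements that act like the
   factor (Z/p)^m. *)
pose PA t := [/\ t \in D, vphi t = 0%R & forall d, d \in D -> Lam (d * t) = Lam d].
have PAd0 : PA d0.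
  split=> //; first by apply/rowP => l; rewrite !mxE phid0.
  move=> t tD; have tdD : t * d0 \in D by rewrite gpredM.
  rewrite -(Lamrep (y0 * rho (a s0)) _ tdD) d0E -mulgA mulgVK mulgA LamE.
    exact: Lamrep.
  have dr : rep y0 * a s0 = d0 * rep (y0 * rho (a s0)) by rewrite d0E mulgVK.
  rewrite -mulgA dr !vphiD // !vrep addr0.
  by congr (_ + _)%R; apply/rowP => l; rewrite !mxE phid0.
have PAX k : PA (d0 ^+ k).
  elim: k => [|k [kD kv kL]].
    split=> [||d _]; rewrite ?expg0 ?gpred1 ?mulg1 //.
    by apply/rowP => l; rewrite !mxE (potential1 (phiD l)).
  have [_ v0 L0] := PAd0; split; first by rewrite expgSr gpredM.
    by rewrite expgSr vphiD // kv v0 addr0.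
  by move=> d dD; rewrite expgSr mulgA L0 ?kL // gpredM.
(* The powers of d0 give an element of the first factor for every value of h. *)
pose A (c : 'F_p) := d0 ^+ (c / h d0)%R.
have hA c : h (A c) = c.
  by rewrite (potentialX _ hD) // natr_Zp divfK //; apply/eqP.
have PAA c : PA (A c) by exact: PAX.
have Omswap y t : t \in D -> Om (t * rep y) = Om (t * A (h (rep y))).
  move=> tD; have [_ vA LA] := PAA (h (rep y)).
  rewrite !OmE Lamrep // LA //; congr (_ * _); apply: UE.
    by rewrite !(hD _ tD) hA.
  by rewrite !vphiD // vrep vA.
have Omflat k t : PA k -> h k = 0%R -> t \in D -> Om (t * k) = Om t.
  move=> [kD kv kL] hk tD; rewrite !OmE kL //; congr (_ * _); apply: UE.
    by rewrite (hD _ tD) hk addr0.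
  by rewrite vphiD // kv addr0.
pose PB t := [/\ t \in D, h t = 0%R & forall d, d \in D -> Om (d * t) = Om d].
have PB1 : PB 1 by split=> [||d _]; rewrite ?gpred1 ?(potential1 hD) ?mulg1.
have PBM t u : PB t -> PB u -> PB (t * u).
  move=> [tD ht tO] [uD hu uO]; split; first exact: gpredM.
    by rewrite (hD _ tD) ht hu addr0.
  by move=> d dD; rewrite mulgA uO ?tO // gpredM.
have PBV t : PB t -> PB t^-1.
  move=> [tD ht tO]; split; first by rewrite gpredV.
    by rewrite (potentialV hD) // ht oppr0.
  by move=> d dD; rewrite -[in RHS](mulgVK t d) tO // gpredM ?gpredV.
(* The Schreier generator sg of an edge along which h is constant need not lie
   over the factor (Z/p)^m: it is flanked by the values of h at the lifts of the
   ends of the edge. They are cancelled by powers of d0, as Om does not distinguish rep y from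
   A (h (rep y)). *)
have PBedge y s : exists2 t, PB t & vphi t = vphi (rep y * a s).
  have [/eqP hE|hN] := boolP (h (rep y * a s) == h (rep y)); last first.
    exists 1 => //; rewrite (_ : vphi (rep y * a s) = 0%R).
      by apply/rowP => l; rewrite !mxE (potential1 (phiD l)).
    rewrite -(vrep y); apply: vphinear; apply: sub_near; apply: hS.
    exact/eqP.
  pose r' := rep (y * rho (a s)).
  have [sg sD sr] : exists2 t, t \in D & rep y * a s = t * r'.
    exists (rep y * a s / r'); last by rewrite mulgVK.
    by apply/(quot_eq _ _ qD); rewrite gmulfM !repK.
  have [AD Av AL] := PAA (- h (rep y))%R.
  have [BD Bv BL] := PAA (h r').
  have AsD : A (- h (rep y))%R * sg \in D by rewrite gpredM.
  exists (A (- h (rep y))%R * sg * A (h r')); last first.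
    rewrite sr (vphiD _ AsD) (vphiD _ AD) (vphiD _ sD) Av Bv vrep.
    by rewrite add0r.
  split; first by rewrite gpredM.
    by rewrite (hD _ AsD) (hD _ AD) !hA -addrA -(hD _ sD) -sr hE addNr.
  move=> t tD; have tAD : t * A (- h (rep y))%R \in D by rewrite gpredM.
  have tAsD : t * A (- h (rep y))%R * sg \in D by rewrite gpredM.
  have -> : t * (A (- h (rep y))%R * sg * A (h r'))
      = t * A (- h (rep y))%R * sg * A (h r') by rewrite !mulgA.
  rewrite -(Omswap _ _ tAsD) -(mulgA _ sg) -sr mulgA OmS; last first.
    by rewrite -mulgA !(hD _ tAD) hE.
  have [CD Cv CL] := PAA (h (rep y)).
  rewrite Omswap // -mulgA Omflat //; last by rewrite (hD _ AD) !hA addNr.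
  split; first exact: gpredM.
    by rewrite vphiD // Av Cv addr0.
  by move=> d dD; rewrite mulgA CL ?AL // gpredM.
(* Hence the values of phi on PB form a subgroup that contains all values of
   phi along edges, so all values of phi. *)
have PBall g : exists2 t, PB t & vphi t = vphi g.
  move: g; apply: (pres_ind presG) => [|g s]; first by exists 1.
  pose r := rep (rho g).
  have gD : g / r \in D by apply/(quot_eq _ _ qD); rewrite repK.
  have [e [eD he eO] ev] := PBedge (rho g) s.
  have gv : vphi g = vphi (g / r).
    by rewrite -[in LHS](mulgVK r g) vphiD // vrep addr0.
  have gsv : vphi (g * a s) = (vphi g + vphi e)%R.
    by rewrite gv ev -vphiD // mulgA mulgVK.
  have PBe : PB e by [].
  have eVv : vphi e^-1 = (- vphi e)%R.
    by apply/rowP => l; rewrite !mxE (potentialV (phiD l)).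
  split=> -[t tB tv]; have [tD _ _] := tB.
    by exists (t * e); [exact: PBM | rewrite vphiD // tv gsv].
  exists (t * e^-1); first by apply: PBM => //; exact: PBV.
  by rewrite vphiD // tv gsv eVv addrK.
pose al := A 1%R.
have [alD alv alL] := PAA 1%R; rewrite -/al in alD alv alL.
have /choice[n nP] : forall j, exists n, [/\ n \in D', Om n = b j &
    exists2 be, be \in D & n = [~ al^-1, be^-1]].
  move=> j; have [t tD tj] := phiF (fun l => (l == j)%:R%R).
  have [be [beD hbe beO] bev] := PBall t.
  have bej : vphi be = delta_mx 0%R j.
    by rewrite bev; apply/rowP => l; rewrite !mxE tj eqxx.
  exists [~ al^-1, be^-1]; split; last by exists be.
    by apply: commg_comm_pow; rewrite gpredV.
  rewrite /commg /conjg !invgK !mulgA.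
  have abD : al * be \in D by rewrite gpredM.
  have abaD : al * be / al \in D by rewrite gpredM ?gpredV.
  have hal : h al = 1%R by exact: hA.
  have OmV : Om (al * be / al / be) = Om (al * be / al).
    have [_ _ VO] := PBV _ (And3 beD hbe beO); exact: VO.
  have LamV : Lam (al * be / al) = Lam (al * be).
    by rewrite -(alL _ abaD) mulgVK.
  rewrite OmV OmE LamV.
  have Uab : U (al * be) = 1.
    by rewrite /U (hD _ alD) hbe addr0 hal vertex_label1.
  have Lab : Lam (al * be) = Lam 1.
    have LamA : Lam al = Lam 1 by rewrite -[al]mul1g alL ?gpred1.
    have Ual : U al = 1 by rewrite /U hal vertex_label1.
    by rewrite -LamA /Lam Uab Ual beO.
  rewrite Lab.
  have -> : Lam 1 = 1.
    rewrite /Lam Om1 /U (potential1 hD).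
    rewrite (_ : vphi 1 = 0%R) ?vertex_label0 ?mulgV //.
    by apply/rowP => l; rewrite !mxE (potential1 (phiD l)).
  have alVv : vphi al^-1 = 0%R.
    rewrite -[LHS]addr0 -[X in (_ + X)%R]alv -vphiD ?gpredV // mulVg.
    by apply/rowP => l; rewrite !mxE (potential1 (phiD l)).
  rewrite mul1g /U (hD _ abD) (hD _ alD) (potentialV hD) // hal hbe addr0 subrr.
  rewrite vphiD // vphiD // alv alVv addr0 add0r bej.
  exact: vertex_label_delta.
have fM : {morph (fun x : subgroup_type D' => Om (val x)) : x y / x / y >-> x / y}.
  move=> x y.
  have xD := valP x; have yD := valP y.
  have E : Om (val x) = Om (val (x / y)) * Om (val y).
    by rewrite -OmD' ?(valP (x / y)) // -gmulfM /= mulgVK.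
  by rewrite E mulgK.
pose f := HB.pack_for {multiplicative subgroup_type D' -> F}
  (fun x : subgroup_type D' => Om (val x))
  (isGroupMorphism.Build (subgroup_type D') F _ fM).
have fE x : f x = Om (val x) by [].
exists f; split.
  have nD' j : n j \in D' by case: (nP j).
  move=> y; have [w ->] := genF y.
  exists (word_val (fun j => SubgroupElt (nD' j)) w).
  rewrite word_val_morph; congr (word_val _ w); apply/funext => j.
  by have [_ <- _] := nP j.
move=> comF.
have qsurj y : exists x, q x = y.
  have [v ->] := pres_gen presG y.
  by exists (word_val b v); rewrite word_val_morph.
have comG (x y : G) : commute x y.
  have [u <-] := qsurj x; have [v <-] := qsurj y.
  by rewrite /commute -!gmulfM comF.
have b1 j : b j = 1.
  have [_ <- [be _ ->]] := nP j.
  by rewrite (_ : [~ al^-1, be^-1] = 1) //; apply/eqP/commgP/comG.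
case: hd0; have [x <-] := qsurj d0; have [w ->] := genF x.
rewrite (_ : word_val b w = 1) ?morph1 ?(potential1 hD) //.
rewrite /word_val big1 // => -[j []] _; rewrite /letter_val /= b1 //.
by rewrite invg1.
Qed.

End FreeQuotient.

(** * Linear growth and the theorem *)
Section Growth.
Variables (p : nat) (G : groupType) (m : nat) (a : 'I_m -> G).
Variable ws : seq (seq ('I_m * bool)).
Hypotheses (pp : prime p) (presG : presents a ws).
Local Notation D := (derived_p_series p G).
Local Notation index i := (subgroup_index (D i)).
Local Notation rank i := (d_p p (subgroup_type (D i))).
Variable M : nat.
Hypothesis growth : forall i, (0 < index i <= M * rank i)%N.

Let index0 i : (0 < index i)%N. Proof. by case/andP: (growth i). Qed.
Let index_rank i : (index i <= M * rank i)%N. Proof. by case/andP: (growth i). Qed.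

Lemma rank_gt0 i : (0 < rank i)%N.
Proof. by case: (rank i) (growth i) => [|//]; rewrite muln0 lt0n leqn0 andNb. Qed.

(** The series cannot stabilize: a nonzero character of D_i kills D_(i+1). *)
Lemma index_gt i : (i < index i)%N.
Proof.
elim: i => [//|i IH]; apply: leq_ltn_trans IH _.
have [Q [rho [qD cQ _]]] := derived_p_series_quotient pp (index0 i).
have [Q' [rho' [qD' cQ' _]]] := derived_p_series_quotient pp (index0 i.+1).
have [pi [piE piC]] := quot_refine qD qD' (@derived_p_series_sub p G i).
rewrite -cQ -cQ' -(piC 1) -[X in (X < _)%N]mul1n ltn_pmul2r ?cQ //.
have [f [fD fF]] := homology_potentials p qD.
have [t tD ft] := fF (fun=> 1%R).
apply/card_gt1P; exists 1, (rho' t); rewrite !inE.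
rewrite -{1}(morph1 rho') !piE morph1 eqxx; split=> //.
  by apply/eqP/(quot_ker qD).
apply/eqP => t1; have tD' : t \in D i.+1 by apply/(quot_ker qD').
have := potential_comm_pow pp (fD (Ordinal (rank_gt0 i))) tD'.
by rewrite ft => /eqP; rewrite oner_eq0.
Qed.

Lemma rank_ge X i : (M * X <= i)%N -> (X <= rank i)%N.
Proof.
move=> Xi; have := leq_trans (leq_ltn_trans Xi (index_gt i)) (index_rank i).
by rewrite ltn_mul2l => /andP[_ /ltnW].
Qed.

Lemma card_edges (Q : finGroupType) (S : {set Q * 'I_m}) : (#|S| <= m * #|Q|)%N.
Proof. by apply: leq_trans (max_card _) _; rewrite card_prod card_ord mulnC. Qed.

Let L := total_length ws.
(* The closedness conditions number at most L m n_i <= (L m M) d_i, and w d_i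
   unknowns outnumber them about twice. *)
Let w := (2 * (L * m * M)).+1.

(** The induction starts with any w independent classes, the support being
    bounded by the set of all edges. *)
Lemma small_supports i0 k : (M * (2 * w.+1) <= i0)%N ->
  exists (Q : finGroupType) (rho : {multiplicative G -> Q})
      (h : 'I_w -> G -> 'F_p) (S : {set Q * 'I_m}),
  [/\ finite_quotient (D (i0 + k)%N) rho, #|Q| = index (i0 + k),
      forall l, potential (D (i0 + k)%N) (h l), jointly_onto (D (i0 + k)%N) h &
      supported a rho h S /\
      ((p ^ w) ^ k * #|S| <= (p ^ w).-1 ^ k * (m * #|Q|))%N].
Proof.
move=> i0w; elim: k => [|k [Q [rho [h [S [qD cQ hD hF [hS cS]]]]]]].
  rewrite addn0.
  have [Q [rho [qD cQ _]]] := derived_p_series_quotient pp (index0 i0).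
  have [f [fD fF]] := homology_potentials p qD.
  have wr : (w <= rank i0)%N by apply: leq_trans (rank_ge i0w); lia.
  exists Q, rho, (fun l => f (widen_ord wr l)), [set: Q * 'I_m].
  split=> //; last first.
    split=> [k g s _|]; first by rewrite inE.
    by rewrite !expn0 !mul1n card_edges.
  move=> v; have [t tD ft] :=
    fF (fun j => if insub (val j) is Some l then v l else 0%R).
  exists t => // l; rewrite ft /= insubT // => lw.
  by congr v; apply: val_inj.
set i := (i0 + k)%N in qD cQ hD hF *.
rewrite addnS -/i.
have [Q' [rho' [qD' cQ' _]]] := derived_p_series_quotient pp (index0 i.+1).
have [f [fD fF]] := homology_potentials p qD.
have enough : (L * #|S| + w * w + w <= rank i * w)%N.
  have wr : (2 * w.+1 <= rank i)%N.
    by apply: rank_ge; apply: leq_trans i0w _; exact: leq_addr.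
  have Sr : (L * #|S| <= L * m * M * rank i)%N.
    rewrite -!mulnA leq_mul2l; apply/orP; right.
    apply: leq_trans (card_edges S) _; rewrite leq_mul2l cQ index_rank orbT //.
  have : (w * (2 * w.+1) <= w * rank i)%N by rewrite leq_mul2l wr orbT.
  move: Sr; rewrite /w; set N := (L * m * M)%N; nia.
have [h' [S' [hD' hF' hS' cS']]] := descent pp presG qD qD' fD fF hD hF hS enough.
exists Q', rho', h', S'; split=> //; split=> //.
have Q0 : (0 < #|Q|)%N by rewrite cQ.
rewrite -(leq_pmul2r Q0) !(expnSr _ k).
move: cS cS'; set A := (p ^ w)%N; set B := A.-1 => cS cS'.
have -> : (A ^ k * A * #|S'| * #|Q| = A ^ k * (A * #|S'| * #|Q|))%N.
  by rewrite !mulnA.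
apply: leq_trans (leq_mul (leqnn _) cS') _.
have -> : (A ^ k * (B * #|S| * #|Q'|) = (A ^ k * #|S|) * (B * #|Q'|))%N by ring.
apply: leq_trans (leq_mul cS (leqnn _)) _.
by apply: eq_leq; ring.
Qed.

Lemma sparse_class (C e : nat) :
  exists i (Q : finGroupType) (rho : {multiplicative G -> Q})
      (h : G -> 'F_p) (S : {set Q * 'I_m}),
  [/\ finite_quotient (D i) rho, potential (D i) h,
      exists2 t, t \in D i & h t <> 0%R,
      forall g s, h (g * a s) <> h g -> (rho g, s) \in S &
      (C * #|S| + e <= rank i)%N].
Proof.
have q1 : (1 < p ^ w)%N by rewrite -[1%N](expn0 p) ltn_exp2l ?prime_gt1.
pose K := (2 * C * (m * M).+1)%N.
have [k kK] := expn_ratio_unbounded K q1.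
pose i0 := (M * (2 * w.+1 + 2 * e))%N.
have [|Q [rho [h [S [qD cQ hD hF [hS cS]]]]]] := @small_supports i0 k.
  by rewrite leq_mul2l leq_addr orbT.
exists (i0 + k)%N, Q, rho, (h ord0), S; split=> //.
- by have [t tD ht] := hF (fun=> 1%R); exists t; rewrite // ht; apply/eqP/oner_neq0.
- by move=> g s; exact: hS.
have er : (2 * e <= rank (i0 + k))%N.
  apply: rank_ge; apply: leq_trans (leq_addr _ _).
  by rewrite leq_mul2l leq_addl orbT.
have KS : (K * #|S| <= m * #|Q|)%N.
  have qk0 : (0 < (p ^ w) ^ k)%N by rewrite expn_gt0 (ltnW q1).
  rewrite -(leq_pmul2l qk0) mulnCA.
  apply: leq_trans (leq_mul (leqnn K) cS) _.
  by rewrite mulnA leq_mul2r kK orbT.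
have CS : (2 * C * #|S| <= rank (i0 + k))%N.
  rewrite -(leq_pmul2l (ltn0Sn (m * M))).
  have -> : ((m * M).+1 * (2 * C * #|S|) = K * #|S|)%N by rewrite /K; ring.
  apply: leq_trans KS _; rewrite mulSn -mulnA; apply: leq_trans (leq_addl _ _).
  by rewrite leq_mul2l cQ index_rank orbT.
lia.
Qed.

End Growth.

Theorem theorem1p12 (R : realType) (G : groupType) (p : nat)
    (hG : finitely_presented G) (hp : prime p)
    (hgrowth : linear_growth R p (derived_p_series p G)) :
  p_large p G.
Proof.
have [m [F [b [q [ws [freeF genF presG]]]]]] := finitely_presented_presentation hG.
have [M growth] := linear_growth_bound hgrowth.
pose L := total_length ws.
have [i [Q [rho [h [S [qD hD [t tD ht] hS cS]]]]]] :=
  sparse_class hp presG growth (L * L).+1 (1 + m).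
have [rep [repK rep1 repT]] := tree_transversal presG (quot_surj qD).
have [y0 [s0 hd0]] : exists y s,
    h (rep y * (q \o b) s / rep (y * rho ((q \o b) s))) <> 0%R.
  apply: contrapT => nex; apply: ht.
  apply: (schreier_potential qD repK rep1 presG hD) tD => y s.
  by apply: contrapT => hys; apply: nex; exists y, s.
set d0 := (_ / _) in hd0.
have d0D : d0 \in derived_p_series p G i.
  by apply/(quot_eq _ _ qD); rewrite gmulfM !repK.
have [f [fD fF]] := homology_potentials p qD.
have [|phi [phiD phiF phirep phid0 phinear]] :=
  @transverse_family p G m (q \o b) _ Q rho qD rep repK rep1 _ m f
    (near_edges (q \o b) ws rho S) d0 fD fF d0D.
  by rewrite -addnA (leq_trans _ cS) // leq_add2r card_near_edges.
have [Om [Om_surj Om_nc]] := free_quotient_of_comm_pow hp genF presG qD repK repT hD hS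
  phiD phiF phirep phinear d0D hd0 phid0 (erefl d0).
have /andP[iN _] := growth i.+1.
have [Q' [_ [_ cQ' [k Qk]]]] := derived_p_series_quotient hp iN.
exists (derived_p_series p G i.+1); split.
- exact: derived_p_series_normal.
- by exists k; rewrite -cQ'.
by exists F, Om; split=> //; exists 'I_m, b.
Qed.
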